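(* Let $1\le k<n$ and let $(Q_1,\ldots,Q_{k+1})$ be a triangular resolution of $(\Gamma,\mathcal{I})$, where $\Gamma\colon(\mathbb{C}^n,0)\to(\mathbb{C}^n,0)$ is a holomorphic map germ and $\mathcal{I}$ a filtration of ideals $I_1\subset\ldots\subset I_{k+1}\subset\mathcal{O}_{n,0}$. Assume $$\mu_j=\operatorname{ord}_{w_j}Q_j<\infty,\qquad 1\le j\le k,$$ and $I_{k+1}\subset I_k+(J)$, where $J$ is the Jacobian determinant of $\Gamma$. Then $Q_{k+1}\circ\Gamma$ can be obtained by applying the Kohn's procedures (P1) and (P2) to $(\psi,I_k)$, where $\psi=(\Gamma_{k+1},\ldots,\Gamma_n)$ are the last $n-k$ components of $\Gamma$ (taken as pre-multipliers, the elements of $I_k$ being taken as multipliers), and each of the procedures (P1) and (P2) is applied $\mu_1\cdots\mu_k$ number of times with the root order in (P2) being $\le k+1$. In particular, if $I_k$ consists of multipliers of order $\ge\varepsilon$, where $0<\varepsilon\le1/2$, then $Q_{k+1}\circ\Gamma$ is a multiplier of order $\ge(2k+2)^{-\mu_1\cdots\mu_k}\varepsilon$.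
   Context: $\mathcal{O}_{n,0}$ is the ring of germs at $0$ of holomorphic functions in $\mathbb{C}^n$. A triangular resolution of length $k\ge1$ and multi-order $(\mu_1,\ldots,\mu_k)\in\mathbb{N}^k$ of a pair $(\Gamma,\mathcal{I})$, where $\Gamma\colon(\mathbb{C}^n,0)\to(\mathbb{C}^n,0)$ is a holomorphic map germ and $\mathcal{I}$ is a filtration of ideals $I_1\subset\ldots\subset I_k\subset\mathcal{O}_{n,0}$, is a system $(h_1,\ldots,h_k)$ of holomorphic function germs at $0\in\mathbb{C}^n$ such that for $1\le j\le k$: $h_j=h_j(w_j,\ldots,w_n)$ depends only on the last $n-j+1$ coordinates, $h_j\circ\Gamma\in I_j$, and $\operatorname{ord}_{w_j}h_j=\mu_j$, where $\operatorname{ord}_{w_j}h_j$ is the vanishing order at $0$ of $w_j\mapsto h_j(w_j,0,\ldots,0)$. Kohn's procedures, for a given set of pre-multipliers and given multipliers with orders, generate new multipliers with orders as follows: (P1) for $0<\varepsilon\le1/2$ and $f_1,\ldots,f_n$ each either a pre-multiplier or a multiplier of order $\ge\varepsilon$, the Jacobian determinant $\det(\partial f_i/\partial z_j)$ is a multiplier of order $\ge\varepsilon/2$; (P2) for $0<\varepsilon<1$, $s,r\in\mathbb{N}_{\ge1}$, multipliers $f_1,\ldots,f_s$ of order $\ge\varepsilon$, and a holomorphic germ $g$ with $g^r\in(f_1,\ldots,f_s)$, $g$ is a multiplier of order $\ge\varepsilon/r$; $r$ is called the root order. *)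

(* Defs.v *)
From HB Require Import structures.
From mathcomp Require Import all_boot all_order all_algebra.
From mathcomp Require Import complex.
From mathcomp Require Import all_classical all_reals all_analysis.

Set Implicit Arguments.
Unset Strict Implicit.
Unset Printing Implicit Defensive.

Import Order.TTheory GRing.Theory Num.Theory.
Import numFieldNormedType.Exports.

Local Open Scope classical_set_scope.
Local Open Scope ring_scope.

(* The complex numbers R[i], named so that the canonical topology and norm of a
   numFieldType are inferred; differentiability below is over this field. *)
Definition Cplx (R : realType) : numClosedFieldType := R[i].

Definition Cn (R : realType) (n : nat) : normedModType (Cplx R) :=
  'rV[Cplx R]_n.

(* Germs at 0 are handled through representatives: total functions, considered
   up to equality near 0. *)
Definition func (R : realType) (n : nat) : Type := Cn R n -> Cplx R.

Definition germ_eq (R : realType) (n : nat) (f g : func R n) : Prop :=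
  \forall z \near (0 : Cn R n), f z = g z.

Definition germ (R : realType) (n : nat) (f : func R n) : set (func R n) :=
  [set g | germ_eq f g].

Definition holo_germ (R : realType) (n : nat) (f : func R n) : Prop :=
  \forall z \near (0 : Cn R n), differentiable f z.

Definition holo_map_germ (R : realType) (n : nat) (G : Cn R n -> Cn R n) :
    Prop :=
  G 0 = 0 /\ \forall z \near (0 : Cn R n), differentiable G z.

Definition component (R : realType) (n : nat) (G : Cn R n -> Cn R n)
    (i : 'I_n) : func R n :=
  fun z => (G z : 'rV[Cplx R]_n) 0 i.

Definition jac_det (R : realType) (n : nat) (F : 'I_n -> func R n) : func R n :=
  fun z => \det (\matrix_(i < n, j < n)
                   'D_(delta_mx 0 j : 'rV[Cplx R]_n) (F i) z).

Record germ_ideal (R : realType) (n : nat) (I : set (func R n)) : Prop := {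
  germ_ideal_holo : forall f, I f -> holo_germ f;
  germ_ideal_germ : forall f g, germ_eq f g -> I f -> I g;
  germ_ideal0 : I (fun=> 0);
  germ_idealD : forall f g, I f -> I g -> I (fun z => f z + g z);
  germ_idealM : forall a f, holo_germ a -> I f -> I (fun z => a z * f z) }.

Definition ideal_gen (R : realType) (n s : nat) (f : 'I_s -> func R n) :
    set (func R n) :=
  [set g | exists2 a : 'I_s -> func R n, (forall i, holo_germ (a i)) &
             germ_eq g (fun z => \sum_(i < s) a i z * f i z)].

Definition ideal_sum (R : realType) (n : nat) (I J : set (func R n)) :
    set (func R n) :=
  [set h | exists f g, [/\ I f, J g & germ_eq h (fun z => f z + g z)]].

(* Families I_j, h_j, mu_j and coordinates w_j are numbered from 1; only the
   indices 1 <= j <= length matter. *)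
Definition ideal_filtration (R : realType) (n l : nat)
    (I : nat -> set (func R n)) : Prop :=
  (forall j, (1 <= j <= l)%N -> germ_ideal (I j)) /\
  (forall j, (1 <= j < l)%N -> I j `<=` I j.+1).

(* The unit vector of the coordinate w_j, i.e. of the ordinal of value j - 1. *)
Definition unit_vec (R : realType) (n j : nat) : Cn R n :=
  \row_(i < n) (i.+1 == j)%:R.

Definition depends_from (R : realType) (n j : nat) (h : func R n) : Prop :=
  \forall z & w \near (0 : Cn R n),
    (forall i : 'I_n, (j <= i.+1)%N ->
       (z : 'rV[Cplx R]_n) 0 i = (w : 'rV[Cplx R]_n) 0 i) ->
    h z = h w.

(* None stands for infinite order. *)
Definition vanishing_order (R : realType) (phi : Cplx R -> Cplx R)
    (m : option nat) : Prop :=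
  match m with
  | Some d => (forall i, (i < d)%N -> derive1n i phi 0 = 0) /\
              derive1n d phi 0 <> 0
  | None => forall i, derive1n i phi 0 = 0
  end.

Definition order_in (R : realType) (n j : nat) (h : func R n)
    (m : option nat) : Prop :=
  vanishing_order (fun t : Cplx R => h (t *: unit_vec R n j)) m.

Definition triangular_resolution (R : realType) (n l : nat)
    (G : Cn R n -> Cn R n) (I : nat -> set (func R n))
    (h : nat -> func R n) (mu : nat -> option nat) : Prop :=
  (1 <= l <= n)%N /\
  forall j, (1 <= j <= l)%N ->
    [/\ holo_germ (h j), depends_from j (h j), I j (h j \o G) &
        order_in j (h j) (mu j)].

(* The germs of the components G_{k+1}, ..., G_n. *)
Definition last_components (R : realType) (n k : nat) (G : Cn R n -> Cn R n) :
    set (func R n) :=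
  [set f | exists2 i : 'I_n, (k.+1 <= i.+1)%N & germ_eq (component G i) f].

(* g results from one application of (P1), resp. of (P2) with root order r, to
   the pre-multipliers P and the multipliers M. *)
Definition kohn_P1 (R : realType) (n : nat) (P M : set (func R n))
    (g : func R n) : Prop :=
  exists2 F : 'I_n -> func R n, (forall i, P (F i) \/ M (F i)) &
    germ_eq g (jac_det F).

Definition kohn_P2 (R : realType) (n : nat) (M : set (func R n)) (r : nat)
    (g : func R n) : Prop :=
  [/\ (1 <= r)%N, holo_germ g &
      exists s (f : 'I_s -> func R n),
        [/\ (1 <= s)%N, forall i, M (f i) &
            ideal_gen f (fun z => g z ^+ r)]].

(* kohn_generates P rmax A p q M: starting from the multipliers A, p
   applications of (P1) and q applications of (P2), in some order, all with root
   orders <= rmax, each producing one new germ, lead to the set M of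
   multipliers. *)
Inductive kohn_generates (R : realType) (n : nat) (P : set (func R n))
    (rmax : nat) (A : set (func R n)) :
    nat -> nat -> set (func R n) -> Prop :=
| kohn_start : kohn_generates P rmax A 0 0 A
| kohn_apply_P1 p q M g : kohn_generates P rmax A p q M ->
    kohn_P1 P M g -> kohn_generates P rmax A p.+1 q (M `|` germ g)
| kohn_apply_P2 p q M r g : kohn_generates P rmax A p q M ->
    (r <= rmax)%N -> kohn_P2 M r g ->
    kohn_generates P rmax A p q.+1 (M `|` germ g).

(* M eps is the set of multipliers of order >= eps; M is any system of
   multipliers with orders which is closed under Kohn's procedures with
   pre-multipliers P (the generated one being the smallest). *)
Record kohn_closed (R : realType) (n : nat) (P : set (func R n))
    (M : R -> set (func R n)) : Prop := {
  kohn_closed_holo : forall eps f, M eps f -> holo_germ f;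
  kohn_closed_germ : forall eps f g, germ_eq f g -> M eps f -> M eps g;
  kohn_closed_le : forall eps delta f,
    0 < delta <= eps -> M eps f -> M delta f;
  kohn_closed_P1 : forall eps g,
    0 < eps <= 1 / 2 -> kohn_P1 P (M eps) g -> M (eps / 2) g;
  kohn_closed_P2 : forall eps r g,
    0 < eps < 1 -> kohn_P2 (M eps) r g -> M (eps / r%:R) g }.

(* Main.v *)
Require Import Defs.
From HB Require Import structures.
From mathcomp Require Import all_boot all_order all_algebra.
From mathcomp Require Import complex.
From mathcomp Require Import all_classical all_reals all_analysis.
From mathcomp Require Import ring lra.

Set Implicit Arguments.
Unset Strict Implicit.
Unset Printing Implicit Defensive.

Import Order.TTheory GRing.Theory Num.Theory.
Import numFieldNormedType.Exports.

Local Open Scope classical_set_scope.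
Local Open Scope ring_scope.

(* Write J for the Jacobian determinant of Gamma and, for a multi-index a with
   1 <= a_i <= mu_i, g_a = Q_{k+1} prod_i d^{a_i} Q_i / dw_i^{a_i}, composed with
   Gamma.  The g_a are obtained as multipliers in lexicographic order (a_k most
   significant), at the cost of one (P1) and one (P2) each; the last one is
   Q_{k+1} o Gamma up to a unit.  For (P1) put in slot i the function Q_i if
   a_i = 1, and otherwise the previously obtained
   Q_{k+1} (d_i^{a_i - 1} Q_i) prod_{l > i} d_l^{a_l} Q_l; since the latter depend
   only on w_i, ..., w_n, the Jacobian matrix is triangular and its determinant is
   J times a product of k factors, each dividing g_a up to a unit.  Since
   Q_{k+1} o Gamma lies in I_k + (J), the power g_a^{k+1} lies in the ideal
   generated by I_k and this determinant, and (P2) yields g_a.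

   Holomorphy of the derivatives of a complex differentiable function is obtained
   without integrals.  Trapezoid sums over the boundary of a square, refined
   dyadically, are additive under subdivision and vanish on affine functions, so
   Goursat's bisection shows that they tend to 0.  Applied to
   (g - g(c))^2 / (z - c) this bounds |g(c)| by 5 times the maximum of |g| on the
   boundary, and applying that to z ((f(z) - f(0)) / z)^n for all n gives a
   Lipschitz estimate.  Iterating it on differences gives a second-order Taylor
   estimate, by which the difference quotients with steps 2^-m converge to a
   differentiable function. *)

(* The norm of a normed module over C takes its values in C; nm is the same norm
   as a real number, for the sake of the linear order. *)
Definition nm (R : realType) (W : normedModType (Cplx R)) (z : W) : R :=
  complex.Re `|z|.

(** * Real-valued norms and the complex modulus *)

Section RealNorm.
Variables (R : realType) (V : normedModType (Cplx R)).

Lemma nmE (z : V) : `|z| = (real_complex R (nm z)) :> Cplx R.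
Proof. by rewrite RRe_real // normr_real. Qed.

Lemma nm_ge0 (z : V) : 0 <= nm z.
Proof. by have := normr_ge0 z; rewrite nmE ler0c. Qed.

Lemma nm0 : nm (0 : V) = 0.
Proof. by rewrite /nm normr0. Qed.

Lemma nm_eq0 (z : V) : (nm z == 0) = (z == 0).
Proof. by rewrite -(normr_eq0 z) nmE eq_complex /= eqxx andbT. Qed.

Lemma nm_gt0 (z : V) : (0 < nm z) = (z != 0).
Proof. by rewrite lt_def nm_ge0 andbT nm_eq0. Qed.

Lemma nmN (z : V) : nm (- z) = nm z.
Proof. by rewrite /nm normrN. Qed.

Lemma nmD (z w : V) : nm (z + w) <= nm z + nm w.
Proof. by rewrite -lecR rmorphD /= -!nmE ler_normD. Qed.

Lemma nmB (z w : V) : nm (z - w) <= nm z + nm w.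
Proof. by rewrite -(nmN w) nmD. Qed.

Lemma nmZ (a : Cplx R) (z : V) : nm (a *: z) = nm a * nm z.
Proof. by apply: complexI; rewrite rmorphM /= -!nmE normrZ. Qed.

End RealNorm.

Section ComplexModulus.
Variable R : realType.
Local Notation C := (Cplx R).
Implicit Types a b : C.

Lemma nmM a b : nm (a * b) = nm a * nm b.
Proof. by apply: complexI; rewrite rmorphM /= -!nmE normrM. Qed.

Lemma nm1 : nm (1 : C) = 1.
Proof. by apply: complexI; rewrite -nmE normr1. Qed.

Lemma nmX a k : nm (a ^+ k) = nm a ^+ k.
Proof. by elim: k => [|k IH]; rewrite ?expr0 ?nm1 // !exprS nmM IH. Qed.

Lemma nmV a : nm a^-1 = (nm a)^-1.
Proof. by apply: complexI; rewrite fmorphV -!nmE normfV. Qed.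

Lemma nm_real (x : R) : nm (real_complex R x : C) = `|x|.
Proof. by rewrite /nm normc_def /= expr0n addr0 sqrtr_sqr. Qed.

Lemma nm_imag (x : R) : nm (Complex 0 x : C) = `|x|.
Proof. by rewrite /nm normc_def /= expr0n add0r sqrtr_sqr. Qed.

Lemma sqr_nm a : nm a ^+ 2 = complex.Re a ^+ 2 + complex.Im a ^+ 2.
Proof.
by rewrite /nm normc_def /= sqr_sqrtr // addr_ge0 // sqr_ge0.
Qed.

Lemma abs_Im_le_nm a : `|complex.Im a| <= nm a.
Proof.
rewrite -(ler_pXn2r (n := 2)) ?nnegrE ?nm_ge0 // sqr_nm real_normK ?num_real //.
by rewrite lerDr sqr_ge0.
Qed.

Lemma abs_Re_le_nm a : `|complex.Re a| <= nm a.
Proof. by rewrite -lecR -nmE normc_ge_Re. Qed.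

Lemma nm_le_ReIm a : nm a <= `|complex.Re a| + `|complex.Im a|.
Proof.
rewrite -(ler_pXn2r (n := 2)) ?nnegrE ?nm_ge0 ?addr_ge0 // sqr_nm.
rewrite sqrrD !real_normK ?num_real // lerD2r lerDl.
by rewrite mulrn_wge0 ?mulr_ge0.
Qed.

End ComplexModulus.

(** * Dyadic trapezoid sums along segments and around squares *)

Section Trapezoid.
Variable R : realType.
Local Notation C := (Cplx R).
Local Notation "x %:C" := (real_complex R x : C).

(** The composite trapezoid rule on $[0,1]$ with $2^N$ equal steps. The recursion halves the
    interval first, so that additivity under subdivision ([edge_sumS]) is read off from the
    definition. *)
Fixpoint dyadic_mean (N : nat) (phi : R -> C) : C :=
  if N is N'.+1 then
    (dyadic_mean N' (fun t => phi (t / 2)) + dyadic_mean N' (fun t => phi ((1 + t) / 2))) / 2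
  else (phi 0 + phi 1) / 2.

Lemma eq_dyadic_mean N (phi psi : R -> C) :
  (forall t, 0 <= t <= 1 -> phi t = psi t) -> dyadic_mean N phi = dyadic_mean N psi.
Proof.
elim: N phi psi => [|N IH] phi psi e /=.
  by rewrite !e // ?lexx ?ler01.
congr ((_ + _) / _); apply: IH => t /andP[t0 t1]; apply: e; lra.
Qed.

Lemma dyadic_meanD N (phi psi : R -> C) :
  dyadic_mean N (fun t => phi t + psi t) = dyadic_mean N phi + dyadic_mean N psi.
Proof.
elim: N phi psi => [|N IH] phi psi /=; last rewrite !IH; ring.
Qed.

Lemma dyadic_meanZ N (c : C) (phi : R -> C) :
  dyadic_mean N (fun t => c * phi t) = c * dyadic_mean N phi.
Proof.
elim: N phi => [|N IH] phi /=; last rewrite !IH; ring.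
Qed.

Lemma dyadic_mean_affine N (c d : C) : dyadic_mean N (fun t => c + t%:C * d) = c + d / 2.
Proof.
elim: N c d => [|N IH] c d /=.
  by rewrite rmorph0 rmorph1; field.
have e1 t : c + (t / 2)%:C * d = c + t%:C * (d / 2).
  by rewrite rmorphM fmorphV rmorph_nat; field.
have e2 t : c + ((1 + t) / 2)%:C * d = (c + d / 2) + t%:C * (d / 2).
  by rewrite rmorphM fmorphV rmorphD rmorph_nat rmorph1; field.
rewrite (@eq_dyadic_mean _ _ (fun t => c + t%:C * (d / 2))) //.
rewrite [X in _ + X](@eq_dyadic_mean _ _ (fun t => (c + d / 2) + t%:C * (d / 2))) //.
by rewrite !IH; field.
Qed.

Lemma nm_half : nm (2^-1 : C) = 2^-1.
Proof. by rewrite nmV -[2]/(2%:R) -(rmorph_nat (real_complex R)) nm_real normr_nat. Qed.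

Lemma nm_dyadic_mean N (phi : R -> C) M :
  (forall t, 0 <= t <= 1 -> nm (phi t) <= M) -> nm (dyadic_mean N phi) <= M.
Proof.
have half (a b : C) : nm a <= M -> nm b <= M -> nm ((a + b) / 2) <= M.
  by move=> ha hb; rewrite nmM nm_half; have := nmD a b; lra.
elim: N phi => [|N IH] phi h /=; apply: half; do ?[by apply: h; lra].
  by apply: IH => t ht; apply: h; lra.
by apply: IH => t ht; apply: h; lra.
Qed.

Lemma Im_dyadic_mean_ge N (phi : R -> C) m :
  (forall t, 0 <= t <= 1 -> m <= complex.Im (phi t)) ->
  m <= complex.Im (dyadic_mean N phi).
Proof.
have half (a b : C) :
    m <= complex.Im a -> m <= complex.Im b -> m <= complex.Im ((a + b) / 2).
  have -> : (a + b) / 2 = (2^-1)%:C * (a + b).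
    by rewrite fmorphV rmorph_nat mulrC.
  by case: a b => [a1 a2] [b1 b2] /=; lra.
elim: N phi => [|N IH] phi h /=; apply: half; do ?[by apply: h; lra].
  by apply: IH => t ht; apply: h; lra.
by apply: IH => t ht; apply: h; lra.
Qed.

(** Stands in for the integral of $f\,dz$ along the segment from [p] to [p + v]. *)
Definition edge_sum (N : nat) (f : C -> C) (p v : C) : C :=
  dyadic_mean N (fun t => f (p + t%:C * v)) * v.

Lemma edge_sumS N f p v :
  edge_sum N.+1 f p v = edge_sum N f p (v / 2) + edge_sum N f (p + v / 2) (v / 2).
Proof.
rewrite /edge_sum /=.
have e1 t : f (p + (t / 2)%:C * v) = f (p + t%:C * (v / 2)).
  by congr f; rewrite rmorphM fmorphV rmorph_nat; field.
have e2 t : f (p + ((1 + t) / 2)%:C * v) = f (p + v / 2 + t%:C * (v / 2)).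
  by congr f; rewrite rmorphM fmorphV rmorphD rmorph_nat rmorph1; field.
rewrite (@eq_dyadic_mean _ _ (fun t => f (p + t%:C * (v / 2)))) //.
rewrite [X in _ + X](@eq_dyadic_mean _ _ (fun t => f (p + v / 2 + t%:C * (v / 2)))) //.
by field.
Qed.

Lemma edge_sumD N f g p v :
  edge_sum N (fun z => f z + g z) p v = edge_sum N f p v + edge_sum N g p v.
Proof. by rewrite /edge_sum dyadic_meanD mulrDl. Qed.

Lemma edge_sumZ N c f p v : edge_sum N (fun z => c * f z) p v = c * edge_sum N f p v.
Proof. by rewrite /edge_sum dyadic_meanZ mulrA. Qed.

Lemma edge_sum_affine N (c d : C) p v :
  edge_sum N (fun z => c + d * z) p v = (c + d * p + d * v / 2) * v.
Proof.
rewrite /edge_sum -(dyadic_mean_affine N (c + d * p) (d * v)).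
by congr (_ * _); apply: eq_dyadic_mean => t _; ring.
Qed.

Lemma nm_edge_sum N f p v M :
  (forall t, 0 <= t <= 1 -> nm (f (p + t%:C * v)) <= M) ->
  nm (edge_sum N f p v) <= M * nm v.
Proof. by move=> h; rewrite nmM ler_wpM2r ?nm_ge0 ?nm_dyadic_mean. Qed.

(** The counterclockwise contour of the square with lower left corner [p] and side [a]; the top and
    left edges are run backwards, hence the minus signs. *)
Definition boundary_sum (N : nat) (f : C -> C) (p : C) (a : R) : C :=
  edge_sum N f p a%:C + edge_sum N f (p + a%:C) (Complex 0 a)
  - edge_sum N f (p + Complex 0 a) a%:C - edge_sum N f p (Complex 0 a).

Lemma boundary_sumD N f g p a : boundary_sum N (fun z => f z + g z) p a = boundary_sum N f p a + boundary_sum N g p a.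
Proof. rewrite /boundary_sum !edge_sumD; ring. Qed.

Lemma boundary_sumZ N c f p a : boundary_sum N (fun z => c * f z) p a = c * boundary_sum N f p a.
Proof. rewrite /boundary_sum !edge_sumZ; ring. Qed.

Lemma boundary_sum_affine N c d p a : boundary_sum N (fun z => c + d * z) p a = 0.
Proof. by rewrite /boundary_sum !edge_sum_affine; field. Qed.

Lemma realC_half (a : R) : a%:C / 2 = (a / 2)%:C.
Proof. by rewrite rmorphM fmorphV rmorph_nat. Qed.

Lemma imagC_half (a : R) : (Complex 0 a : C) / 2 = Complex 0 (a / 2).
Proof.
have -> : (2^-1 : C) = (2^-1)%:C by rewrite fmorphV rmorph_nat.
by apply/eqP; rewrite eq_complex /=; apply/andP; split; apply/eqP; ring.
Qed.

(** The edges inside the large square are traversed twice in opposite directions and cancel. *)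
Lemma boundary_sumS N f p a (h := a / 2) :
  boundary_sum N.+1 f p a = boundary_sum N f p h + boundary_sum N f (p + h%:C) h
                   + boundary_sum N f (p + Complex 0 h) h
                   + boundary_sum N f (p + h%:C + Complex 0 h) h.
Proof.
rewrite /boundary_sum !edge_sumS !realC_half !imagC_half -/h.
have ea : a%:C = h%:C + h%:C by rewrite -rmorphD /h -splitr.
have eb : (Complex 0 a : C) = Complex 0 h + Complex 0 h.
  by apply/eqP; rewrite eq_complex /= addr0 /h -splitr !eqxx.
rewrite ea eb; move: (h%:C) (Complex 0 h : C) => x y.
by rewrite !addrA !(addrAC _ y x); ring.
Qed.

Definition in_square (p : C) (a : R) (z : C) : Prop :=
  [/\ complex.Re p <= complex.Re z <= complex.Re p + a &
      complex.Im p <= complex.Im z <= complex.Im p + a].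

Definition on_square_boundary (p : C) (a : R) (z : C) : Prop :=
  in_square p a z /\
  (complex.Re z = complex.Re p \/ complex.Re z = complex.Re p + a \/
   complex.Im z = complex.Im p \/ complex.Im z = complex.Im p + a).

Lemma nm_boundary_sum N f p a M : 0 <= a ->
  (forall z, on_square_boundary p a z -> nm (f z) <= M) ->
  nm (boundary_sum N f p a) <= 4 * a * M.
Proof.
move=> a0 h.
have b1 : nm (edge_sum N f p a%:C) <= M * a.
  rewrite -{2}[a]ger0_norm // -nm_real; apply: nm_edge_sum => t ht; apply: h.
  by case: (p) => p1 p2; split; [split; rewrite /=; nra|right; right; left; rewrite /=; ring].
have b2 : nm (edge_sum N f (p + a%:C) (Complex 0 a)) <= M * a.
  rewrite -{3}[a]ger0_norm // -nm_imag; apply: nm_edge_sum => t ht; apply: h.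
  by case: (p) => p1 p2; split; [split; rewrite /=; nra|right; left; rewrite /=; ring].
have b3 : nm (edge_sum N f (p + Complex 0 a) a%:C) <= M * a.
  rewrite -{3}[a]ger0_norm // -nm_real; apply: nm_edge_sum => t ht; apply: h.
  by case: (p) => p1 p2; split; [split; rewrite /=; nra|right; right; right; rewrite /=; ring].
have b4 : nm (edge_sum N f p (Complex 0 a)) <= M * a.
  rewrite -{2}[a]ger0_norm // -nm_imag; apply: nm_edge_sum => t ht; apply: h.
  by case: (p) => p1 p2; split; [split; rewrite /=; nra|left; rewrite /=; ring].
rewrite /boundary_sum; set s1 := edge_sum _ _ _ _ in b1 *; set s2 := edge_sum _ _ _ _ in b2 *.
set s3 := edge_sum _ _ _ _ in b3 *; set s4 := edge_sum _ _ _ _ in b4 *.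
have := nmB (s1 + s2 - s3) s4; have := nmB (s1 + s2) s3; have := nmD s1 s2.
lra.
Qed.

Lemma in_square_diam p a z w : 0 <= a -> in_square p a z -> in_square p a w ->
  nm (z - w) <= 2 * a.
Proof.
move=> a0 [z1 z2] [w1 w2]; apply: le_trans (nm_le_ReIm _) _.
have -> : complex.Re (z - w) = complex.Re z - complex.Re w by case: z w {z1 z2 w1 w2} => ? ? [].
have -> : complex.Im (z - w) = complex.Im z - complex.Im w by case: z w {z1 z2 w1 w2} => ? ? [].
have h1 : `|complex.Re z - complex.Re w| <= a by rewrite ler_norml; apply/andP; split; lra.
have h2 : `|complex.Im z - complex.Im w| <= a by rewrite ler_norml; apply/andP; split; lra.
lra.
Qed.

(* d plays the role of the derivative of f at c. *)
Definition has_cderivative (f : C -> C) (c d : C) : Prop :=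
  forall e : R, 0 < e -> exists2 r : R, 0 < r &
    forall z, nm (z - c) < r -> nm (f z - f c - d * (z - c)) <= e * nm (z - c).

(** Smallness is measured against the area $a^2$, so that the bounds for the four quarter squares
    add up to the bound for the whole. *)
Definition small_boundary_sum f p a (e : R) : Prop :=
  exists N0, forall N, (N0 <= N)%N -> nm (boundary_sum N f p a) <= e * a ^+ 2.

Lemma small_boundary_sumS f p a e (h := a / 2) :
  small_boundary_sum f p h e -> small_boundary_sum f (p + h%:C) h e ->
  small_boundary_sum f (p + Complex 0 h) h e ->
  small_boundary_sum f (p + h%:C + Complex 0 h) h e -> small_boundary_sum f p a e.
Proof.
move=> [N1 h1] [N2 h2] [N3 h3] [N4 h4].
(* The successor pays for the level of refinement lost in passing to the quarters. *)
exists (maxn (maxn N1 N2) (maxn N3 N4)).+1 => -[//|N].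
rewrite ltnS !geq_max => /andP[/andP[n1 n2] /andP[n3 n4]].
rewrite boundary_sumS -/h; move: {h1 h2 h3 h4} (h1 _ n1) (h2 _ n2) (h3 _ n3) (h4 _ n4).
set s1 := boundary_sum _ _ _ _; set s2 := boundary_sum _ _ _ _; set s3 := boundary_sum _ _ _ _.
set s4 := boundary_sum _ _ _ _.
have -> : a = 2 * h by rewrite /h mulrC divfK ?pnatr_eq0.
have := nmD (s1 + s2 + s3) s4; have := nmD (s1 + s2) s3; have := nmD s1 s2.
lra.
Qed.

(** On a small square around [c] the function differs from an affine one by at most
    $(e/8)|z-c|\le(e/8)\,2a$, and the perimeter is $4a$. *)
Lemma small_boundary_sum_near f c d e : 0 < e -> has_cderivative f c d ->
  exists2 r : R, 0 < r & forall p a, 0 < a < r -> in_square p a c -> small_boundary_sum f p a e.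
Proof.
move=> e0 fd; have e8 : 0 < e / 8 by lra.
have [r r0 hr] := fd _ e8; exists (r / 2); first lra.
move=> p a /andP[a0 ar] pc; exists 0%N => N _.
pose g z := f z - f c - d * (z - c).
have -> : boundary_sum N f p a = boundary_sum N g p a.
  have -> : f = (fun z => g z + ((f c - d * c) + d * z)).
    by apply/funext => z; rewrite /g; ring.
  by rewrite boundary_sumD boundary_sum_affine addr0.
have -> : e * a ^+ 2 = 4 * a * (e / 8 * (2 * a)) by field.
apply: nm_boundary_sum (ltW a0) _ => z [zp _].
have zc : nm (z - c) <= 2 * a by apply: in_square_diam zp pc; exact: ltW.
apply: le_trans (hr _ _) _; first lra.
by rewrite ler_wpM2l // ltW.
Qed.

End Trapezoid.

(** * Nested intervals and Goursat's bisection *)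

Lemma nested_intervals (R : realType) (l s : nat -> R) :
  (forall n, 0 <= s n) -> (forall n, l n <= l n.+1) ->
  (forall n, l n.+1 + s n.+1 <= l n + s n) ->
  exists x, forall n, l n <= x <= l n + s n.
Proof.
move=> s0 lS rS.
have lmono m k : l m <= l (m + k)%N.
  by elim: k => [|k IH]; rewrite ?addn0 // addnS (le_trans IH).
have rmono m k : l (m + k)%N + s (m + k)%N <= l m + s m.
  by elim: k => [|k IH]; rewrite ?addn0 // addnS (le_trans (rS _)).
(* A left end and a right end are compared at the common later index [m + n]. *)
have lr m n : l m <= l n + s n.
  have := lmono m n; have := rmono n m; rewrite addnC; have := s0 (m + n)%N; lra.
exists (sup (range l)) => n; apply/andP; split.
  apply: sup_upper_bound; last by exists n.
  by split; [exists (l 0%N), 0%N|exists (l 0%N + s 0%N) => _ [m _ <-]].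
by apply: ge_sup => [|_ [m _ <-]]; first by exists (l 0%N), 0%N.
Qed.

Section Goursat.
Variable R : realType.
Local Notation C := (Cplx R).
Local Notation "x %:C" := (real_complex R x : C).

Lemma bisect_boundary_sum (f : C -> C) (p : C) (a e : R) (h := a / 2) : 0 < a ->
  ~ small_boundary_sum f p a e -> exists q : C,
  [/\ ~ small_boundary_sum f q h e, complex.Re p <= complex.Re q <= complex.Re p + h &
      complex.Im p <= complex.Im q <= complex.Im p + h].
Proof.
move=> a0 hb; apply: contrapT => hn; apply: hb; apply: small_boundary_sumS;
  apply: contrapT => hq; apply: hn; eexists; split; try exact: hq;
  case: (p) => p1 p2; rewrite /= /h; lra.
Qed.

(** A bad square has a bad quarter. Iteration gives bad squares shrinking to a point of
    differentiability, where [small_boundary_sum_near] excludes them. *)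
Lemma goursat (f : C -> C) (p : C) (a e : R) : 0 < a -> 0 < e ->
  (forall z, in_square p a z -> exists d, has_cderivative f z d) -> small_boundary_sum f p a e.
Proof.
move=> a0 e0 fd; apply: contrapT => bad.
have /choice[next nextP] : forall qh : C * R, exists q : C, 0 < qh.2 ->
    ~ small_boundary_sum f qh.1 qh.2 e ->
    [/\ ~ small_boundary_sum f q (qh.2 / 2) e,
      complex.Re qh.1 <= complex.Re q <= complex.Re qh.1 + qh.2 / 2 &
      complex.Im qh.1 <= complex.Im q <= complex.Im qh.1 + qh.2 / 2].
  (* The choice function is total; 0 is a dummy value for squares that are not bad. *)
  move=> [q h] /=; have [h0|h0] := ltP 0 h; last by exists 0.
  have [hb|hb] := pselect (~ small_boundary_sum f q h e); last by exists 0.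
  by have [q' hq'] := bisect_boundary_sum h0 hb; exists q'.
pose u n := iter n (fun qh => (next qh, qh.2 / 2)) (p, a).
have us n : (u n).2 = a / 2 ^+ n.
  elim: n => [|n IH]; first by rewrite expr0 divr1.
  by rewrite /= IH exprS; field.
have us0 n : 0 < (u n).2 by rewrite us divr_gt0 // exprn_gt0.
have ubad n : ~ small_boundary_sum f (u n).1 (u n).2 e.
  by elim: n => [//|n IH]; have [] := nextP _ (us0 n) IH.
have ustep n := nextP _ (us0 n) (ubad n).
have usS n : (u n.+1).2 = (u n).2 / 2 by [].
have [x hx] : exists x, forall n,
    complex.Re (u n).1 <= x <= complex.Re (u n).1 + (u n).2.
  apply: nested_intervals => n; first exact: ltW.
    by have [_ /andP[]] := ustep n.
  by rewrite usS; have [_ /andP[_ h] _] := ustep n; rewrite /= in h *; lra.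
have [y hy] : exists y, forall n,
    complex.Im (u n).1 <= y <= complex.Im (u n).1 + (u n).2.
  apply: nested_intervals => n; first exact: ltW.
    by have [_ _ /andP[]] := ustep n.
  by rewrite usS; have [_ _ /andP[_ h]] := ustep n; rewrite /= in h *; lra.
have inq n : in_square (u n).1 (u n).2 (Complex x y) by split; [exact: hx|exact: hy].
have [d /(small_boundary_sum_near e0)[r r0 hr]] := fd _ (inq 0%N).
have [n hn] : exists n, (u n).2 < r.
  exists (Num.Def.archi_bound (a / r)); rewrite us ltr_pdivrMr ?exprn_gt0 //.
  rewrite mulrC -ltr_pdivrMr //.
  apply: lt_le_trans (archi_boundP _) _; first by rewrite divr_ge0 // ltW.
  by rewrite -natrX ler_nat ltnW // ltn_expl.
by apply: (ubad n); apply: hr (inq n); rewrite us0.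
Qed.

End Goursat.

(** * Neighbourhoods, continuity and differentials in terms of the real norm *)

Section Nbhs.
Variables (R : realType).
Lemma nbhs_nmP (V : normedModType (Cplx R)) (x : V) (P : set V) :
  nbhs x P <-> exists2 r : R, 0 < r & forall y, nm (y - x) < r -> P y.
Proof.
split=> [/nbhs_normP[e e0 he]|[r r0 hr]].
  exists (complex.Re e); first by move: e0; rewrite /= ltcE => /andP[].
  move=> y hy; apply: he; rewrite /= distrC nmE.
  have -> : e = real_complex R (complex.Re e).
    by rewrite RRe_real // gtr0_real.
  by rewrite ltcR.
apply/nbhs_normP; exists (real_complex R r); first by rewrite /= ltcR.
by move=> y /=; rewrite distrC nmE ltcR; exact: hr.
Qed.

Lemma nearP_nm (V : normedModType (Cplx R)) (x : V) (P : V -> Prop) :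
  (\forall y \near x, P y) <->
  exists2 r : R, 0 < r & forall y, nm (y - x) < r -> P y.
Proof. exact: nbhs_nmP. Qed.

Variables (V W : normedModType (Cplx R)).

Lemma continuous_nm (f : V -> W) (x : V) :
  (forall e : R, 0 < e -> exists2 r : R, 0 < r & forall y, nm (y - x) < r ->
    nm (f y - f x) < e) -> {for x, continuous f}.
Proof.
move=> h P /(nbhs_nmP (V := W))[e /h[r r0 hr] he]; apply/nbhs_nmP.
by exists r => // y /hr /he.
Qed.

Lemma nm_continuous (f : V -> W) (x : V) : {for x, continuous f} ->
  forall e : R, 0 < e -> exists2 r : R, 0 < r & forall y, nm (y - x) < r ->
    nm (f y - f x) < e.
Proof.
move=> fx e e0; suff /fx/nbhs_nmP : nbhs (f x) [set y | nm (y - f x) < e] by [].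
by apply/(nbhs_nmP (V := W)); exists e.
Qed.

End Nbhs.

Section Nbhs2.
Variables (R : realType) (V W : normedModType (Cplx R)).

Lemma differentiable_nm (f : V -> W) (x : V) : differentiable f x ->
  forall e : R, 0 < e -> exists2 r : R, 0 < r & forall h, nm h < r ->
    nm (f (x + h) - f x - 'd f x h) <= e * nm h.
Proof.
move=> fx e e0; have /diff_locally/eqaddoP/(_ (real_complex R e)) := fx.
rewrite ltcR => /(_ e0) /nearP_nm[r r0 hr]; exists r => // h hh.
have := hr h; rewrite subr0 => /(_ hh) /=.
rewrite !nmE -rmorphM lecR /= opprD addrA.
by rewrite !fctE /= (addrC h).
Qed.

(** Lets the differential be given as a plain function [L]. The bound makes [L] continuous, and
    since the differential is defined by choice, exhibiting one map with the first-order expansion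
    suffices. *)
Lemma nm_differentiable (f : V -> W) (x : V) (L : V -> W) (K : R) :
  linear L -> (forall h, nm (L h) <= K * nm h) ->
  (forall e : R, 0 < e -> exists2 r : R, 0 < r & forall h, nm h < r ->
    nm (f (x + h) - f x - L h) <= e * nm h) ->
  differentiable f x.
Proof.
move=> linL LK fL.
pose df : {linear V -> W} := HB.pack L (GRing.isLinear.Build _ _ _ _ L linL).
have dfc : continuous df.
  (* [K] is not assumed positive; [K'] is a positive bound. *)
  move=> y; apply: continuous_nm => e e0; pose K' := Num.max K 0 + 1.
  have K'0 : 0 < K' by rewrite /K' ltr_wpDl // le_max lexx orbT.
  exists (e / K'); first by rewrite divr_gt0.
  move=> z; rewrite ltr_pdivlMr // => zy; apply: le_lt_trans zy.
  rewrite -linearB; apply: le_trans (LK _) _; rewrite mulrC ler_wpM2l ?nm_ge0 //.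
  by rewrite /K' (@le_trans _ _ (Num.max K 0)) ?le_max ?lexx // lerDl.
apply/diffP; apply: (@getPex _ (fun (df : {linear V -> W}) => continuous df /\
  forall y, f y = f (lim (nbhs x)) + df (y - lim (nbhs x))
                  +o_(y \near x) (y - lim (nbhs x)))).
exists df; split=> //; rewrite lim_id //.
have /eqaddoP E : forall e : Cplx R, 0 < e -> \forall y \near x,
    `|(f - (fun y => f x + df (y - x))) y| <= e * `|(fun y => y - x) y|.
  move=> e e0; have eE : e = real_complex R (complex.Re e).
    by rewrite RRe_real // gtr0_real.
  rewrite eE ltcR in e0; have [r r0 hr] := fL _ e0.
  apply/nearP_nm; exists r => // y yx; rewrite !fctE /= eE !nmE -rmorphM lecR /=.
  by have := hr _ yx; rewrite subrKC opprD addrA.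
by move=> z; exact: (congr1 (fun h => h z) E).
Qed.

End Nbhs2.

Lemma differentiable_exp (R : realType) (V : normedModType (Cplx R))
    (f : V -> Cplx R) (x : V) n :
  differentiable f x -> differentiable (fun z => f z ^+ n) x.
Proof.
move=> fx; elim: n => [|n IH]; first exact: differentiable_cst.
have -> : (fun z => f z ^+ n.+1) = (fun z => f z * f z ^+ n).
  by apply/funext => z; rewrite exprS.
exact: differentiableM.
Qed.

(** * A maximum principle with the constant 5 *)

Section WeakMaximum.
Variable R : realType.
Local Notation C := (Cplx R).
Local Notation "x %:C" := (real_complex R x : C).

Lemma diff_mul1 (f : C -> C) (c h : C) : differentiable f c ->
  'd f c h = 'd f c 1 * h.
Proof. by move=> fc; rewrite -{1}[h]mulr1 -[h * 1]/(h *: 1) linearZ mulrC. Qed.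

Lemma differentiable_cderivative (f : C -> C) (c : C) :
  differentiable f c -> has_cderivative f c ('d f c 1).
Proof.
move=> fc e /(differentiable_nm fc)[r r0 hr]; exists r => // z zc.
by have := hr _ zc; rewrite subrKC (diff_mul1 (z - c) fc).
Qed.

Definition diff_quot (g : C -> C) (c z : C) : C := (g z - g c) / (z - c).

(** The quotient tends to $g'(c)$, although division by zero gives it the value 0 at [c]. The factor
    [z - c] hides that value and yields the derivative $g'(c)^n$. *)
Lemma cderivative_diff_quot_pow (g : C -> C) (c : C) n : differentiable g c ->
  exists d, has_cderivative (fun z => (z - c) * diff_quot g c z ^+ n) c d.
Proof.
move=> gc; set D := 'd g c 1; exists (D ^+ n) => e e0.
have dD : differentiable (@id C) D by exact: (@ex_diff _ _ _ _ _ _ _ (is_diff_id D)).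
have powc : {for D, continuous (fun w : C => w ^+ n)}.
  apply: differentiable_continuous; exact: (@differentiable_exp R _ (fun w => w) D n dD).
have [s s0 hs] := nm_continuous powc e0.
have s20 : 0 < s / 2 by rewrite divr_gt0.
have [r r0 hr] := differentiable_cderivative gc s20; exists r => // z zc.
rewrite subrr mul0r subr0 -/D.
have [->|zNc] := eqVneq z c; first by rewrite !subrr !mul0r mulr0 subrr !nm0 mulr0.
rewrite (mulrC (D ^+ n)) -mulrBr nmM mulrC ler_wpM2r ?nm_ge0 // ltW // hs //.
have zc0 : 0 < nm (z - c) by rewrite nm_gt0 subr_eq0.
have -> : diff_quot g c z - D = (g z - g c - D * (z - c)) / (z - c).
  by rewrite /diff_quot [RHS]mulrBl mulfK // subr_eq0.
rewrite nmM nmV ltr_pdivrMr //; apply: le_lt_trans (hr _ zc) _.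
by rewrite ltr_pM2r //; lra.
Qed.

Lemma differentiable_diff_quot_pow (g : C -> C) (c z : C) n : z != c ->
  differentiable g z -> differentiable (fun z => (z - c) * diff_quot g c z ^+ n) z.
Proof.
move=> zc gz.
have d1 : differentiable (fun z : C => z - c) z by exact: differentiableB.
apply: (@differentiableM _ _ (fun z => z - c) (fun z => diff_quot g c z ^+ n)) => //.
apply: (@differentiable_exp _ _ (diff_quot g c)).
apply: (@differentiableM _ _ (fun z => g z - g c) (fun z => (z - c)^-1)).
  exact: differentiableB.
by apply: (@differentiableV _ _ (fun z => z - c)) => //=; rewrite subr_eq0.
Qed.

(** $\operatorname{Im}(v/z)=\operatorname{Im}(v\bar z)/|z|^2$, and the hypothesis bounds the
    numerator below by $|z|^2$. *)
Lemma Im_div_ge1 (v z : C) :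
  0 < nm z -> nm z ^+ 2 <= complex.Im v * complex.Re z - complex.Re v * complex.Im z ->
  1 <= complex.Im (v * z^-1).
Proof.
case: v z => [v1 v2] [a b] z0; have := exprn_gt0 2 z0; rewrite sqr_nm /= => n0 h.
have -> : v1 * - (b / (a ^+ 2 + b ^+ 2)) + v2 * (a / (a ^+ 2 + b ^+ 2)) =
  (v2 * a - v1 * b) / (a ^+ 2 + b ^+ 2) by field; rewrite gt_eqF.
by rewrite ler_pdivlMr // mul1r.
Qed.

Definition corner (c : C) (rho : R) : C := c - Complex rho rho.

(** Replaces the integral $2\pi i$ of $1/(z-c)$. On an edge with oriented direction [w] one has
    $\operatorname{Im}(w\overline{(z-c)})=2\rho^2\ge|z-c|^2$, so each edge contributes at least
    1. *)
Lemma Im_boundary_sum_inv N (c : C) (rho : R) : 0 < rho ->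
  4 <= complex.Im (boundary_sum N (fun z => (z - c)^-1) (corner c rho) (2 * rho)).
Proof.
move=> r0.
have edge p v w : (forall t z, 0 <= t <= 1 -> z = p + t%:C * v - c ->
    0 < nm z ^+ 2 <= complex.Im w * complex.Re z - complex.Re w * complex.Im z) ->
    1 <= complex.Im (dyadic_mean N (fun t => (p + t%:C * v - c)^-1) * w).
  move=> h; rewrite mulrC -dyadic_meanZ; apply: Im_dyadic_mean_ge => t ht; have /andP[z0 zv] := h t _ ht erefl.
  apply: Im_div_ge1 => //; rewrite lt_def nm_ge0 andbT.
  by apply: contraTneq z0 => ->; rewrite expr0n ltxx.
rewrite /boundary_sum /edge_sum -!mulrN !raddfD /= (_ : 4 = 1 + 1 + 1 + 1 :> R); last by ring.
have r2 : 0 < rho ^+ 2 by rewrite exprn_gt0.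
have key t : 0 <= t <= 1 ->
    0 < rho ^+ 2 * ((2 * t - 1) ^+ 2 + 1) <= 2 * rho ^+ 2.
  move=> /andP[t0 t1]; rewrite pmulr_rgt0 // ltr_wpDl ?sqr_ge0 //= mulrC ler_wpM2r ?(ltW r2) //.
  by have := mulr_ge0 t0 (_ : 0 <= 1 - t); rewrite subr_ge0 => /(_ t1); lra.
by do 3?[apply: lerD]; apply: edge => t z /key/andP[k1 k2] ->;
  rewrite /corner sqr_nm; case: (c) => c1 c2 /=; apply/andP; split; lra.
Qed.

Lemma corner_square (c z : C) (rho : R) :
  in_square (corner c rho) (2 * rho) z -> nm (z - c) <= 2 * rho.
Proof.
case: c z => [c1 c2] [z1 z2] [/= h1 h2]; apply: le_trans (nm_le_ReIm _) _ => /=.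
have : `|z1 - c1| <= rho by rewrite ler_norml; apply/andP; split; lra.
have : `|z2 - c2| <= rho by rewrite ler_norml; apply/andP; split; lra.
lra.
Qed.

Lemma corner_boundary (c z : C) (rho : R) : 0 < rho ->
  on_square_boundary (corner c rho) (2 * rho) z -> rho <= nm (z - c).
Proof.
move=> r0; case: c z => [c1 c2] [z1 z2] [_ /=] h.
have [e|e] : `|z1 - c1| = rho \/ `|z2 - c2| = rho.
- case: h => [->|[->|[->|->]]]; [left|left|right|right].
  + by rewrite (_ : c1 - rho - c1 = - rho) ?normrN ?gtr0_norm //; ring.
  + by rewrite (_ : c1 - rho + 2 * rho - c1 = rho) ?gtr0_norm //; ring.
  + by rewrite (_ : c2 - rho - c2 = - rho) ?normrN ?gtr0_norm //; ring.
  + by rewrite (_ : c2 - rho + 2 * rho - c2 = rho) ?gtr0_norm //; ring.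
- by have := abs_Re_le_nm (Complex (z1 - c1) (z2 - c2)); rewrite /= e.
- by have := abs_Im_le_nm (Complex (z1 - c1) (z2 - c2)); rewrite /= e.
Qed.

(* Goursat is applied to (g - g c)^2 / (z - c): the square makes it differentiable
   at c, where the plain difference quotient is only known to be continuous. *)
Lemma weak_max (g : C -> C) (c : C) (rho M : R) : 0 < rho ->
  (forall z, nm (z - c) <= 2 * rho -> differentiable g z) ->
  (forall z, rho <= nm (z - c) <= 2 * rho -> nm (g z) <= M) ->
  nm (g c) <= 5 * M.
Proof.
move=> r0 gd gM; have M0 : 0 <= M.
  apply: le_trans (nm_ge0 (g (c + rho%:C))) (gM _ _).
  by rewrite addrAC subrr add0r nm_real gtr0_norm //; lra.
rewrite leNgt; apply/negP; set x := nm (g c) => xM.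
(* Expanding the square, the sum of [f] is $g(c)^2$ times that of $1/(z-c)$, of modulus at least
   $4x^2$, plus that of [u], of modulus at most $8(M^2+2xM)$. The difference [gap] of these bounds
   is positive for $x>5M$, and [e] makes Goursat's bound half of it. *)
pose gap := 4 * x ^+ 2 - 16 * x * M - 8 * M ^+ 2.
have gap0 : 0 < gap by rewrite /gap; nra.
pose e := gap / (8 * rho ^+ 2).
have e0 : 0 < e by rewrite divr_gt0 // mulr_gt0 // exprn_gt0.
pose f z := (z - c) * diff_quot g c z ^+ 2.
have r20 : 0 < 2 * rho by rewrite mulr_gt0.
have [|N0 hN] := @goursat R f (corner c rho) (2 * rho) e r20 e0.
  move=> z /corner_square zc; have [->|zNc] := eqVneq z c.
    by apply: cderivative_diff_quot_pow; apply: gd; rewrite subrr nm0; lra.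
  exists ('d f z 1); apply: differentiable_cderivative.
  by apply: differentiable_diff_quot_pow => //; exact: gd.
move/(_ _ (leqnn _)): hN; set N := N0.
pose k z := (z - c)^-1; pose u z := (g z ^+ 2 - 2 * g c * g z) * k z.
have -> : boundary_sum N f (corner c rho) (2 * rho) =
    boundary_sum N u (corner c rho) (2 * rho) + g c ^+ 2 * boundary_sum N k (corner c rho) (2 * rho).
  rewrite -boundary_sumZ -boundary_sumD; congr boundary_sum; apply/funext => z; rewrite /f /diff_quot /u /k.
  have [->|zNc] := eqVneq z c; first by rewrite subrr invr0 !mulr0 mul0r addr0.
  by field; rewrite subr_eq0.
have uM : nm (boundary_sum N u (corner c rho) (2 * rho)) <= 4 * (2 * rho) * ((M ^+ 2 + 2 * x * M) / rho).
  apply: nm_boundary_sum => [|z zb]; first by rewrite mulr_ge0 // ltW.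
  have z1 := corner_boundary r0 zb; have z2 := corner_square zb.1.
  have gz : nm (g z) <= M by apply: gM; rewrite z1 z2.
  rewrite /u nmM; apply: ler_pM; rewrite ?nm_ge0 //.
    apply: le_trans (nmB _ _) _; rewrite nmX !nmM.
    have -> : nm (2 : C) = 2 by rewrite -(rmorph_nat (real_complex R)) nm_real normr_nat.
    rewrite -/x; apply: lerD; first by rewrite lerXn2r // nnegrE ?nm_ge0.
    by rewrite ler_wpM2l // mulr_ge0 ?nm_ge0.
  by rewrite /k nmV lef_pV2 // posrE (lt_le_trans r0).
have kM : 4 <= nm (boundary_sum N k (corner c rho) (2 * rho)).
  exact: le_trans (Im_boundary_sum_inv N c r0) (le_trans (ler_norm _) (abs_Im_le_nm _)).
set b := boundary_sum _ _ _ _ in uM *; set d := boundary_sum _ _ _ _ in kM *.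
move=> hN; have := nmB (b + g c ^+ 2 * d) b; rewrite addrAC subrr add0r.
rewrite nmM nmX -/x.
have : e * (2 * rho) ^+ 2 = gap / 2 by rewrite /e; field; rewrite gt_eqF.
have : 4 * (2 * rho) * ((M ^+ 2 + 2 * x * M) / rho) = 8 * (M ^+ 2 + 2 * x * M).
  by field; rewrite gt_eqF.
have : x ^+ 2 * 4 <= x ^+ 2 * nm d by rewrite ler_wpM2l // sqr_ge0.
rewrite /gap in gap0 *; lra.
Qed.

End WeakMaximum.

(** * Growth of powers and the Lipschitz estimate on a disc *)

Lemma bernoulli_ge (R : realFieldType) (y : R) n : 1 <= y -> 1 + n%:R * (y - 1) <= y ^+ n.
Proof.
move=> y1; elim: n => [|n IH]; first by rewrite expr0 mul0r addr0.
rewrite exprS -natr1; have n0 : 0 <= n%:R :> R by rewrite ler0n.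
have y10 : 0 <= y - 1 by lra.
have := mulr_ge0 (mulr_ge0 n0 y10) y10; have := ler_wpM2l (_ : 0 <= y) IH.
move=> /(_ _); have yy : 0 <= y by lra.
by move=> /(_ yy); lra.
Qed.

(** Constants disappear on taking [n]-th roots: if $x>K>0$, the powers $(x/K)^n$ are unbounded by
    Bernoulli's inequality. For [K = 0] the exponent 1 suffices. *)
Lemma le_of_pow_le (R : realType) (a B K x : R) : 0 < a -> 0 <= K ->
  (forall n, a * x ^+ n <= B * K ^+ n) -> x <= K.
Proof.
move=> a0 K0 h; rewrite leNgt; apply/negP => Kx.
have [K00|Kn0] := eqVneq K 0.
  have := h 1%N; rewrite !expr1 K00 mulr0; rewrite K00 in Kx.
  by have := mulr_gt0 a0 Kx; lra.
have Kp : 0 < K by rewrite lt_def Kn0.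
set y := x / K; have y1 : 1 < y by rewrite ltr_pdivlMr // mul1r.
have hy n : a * y ^+ n <= B.
  by rewrite /y expr_div_n mulrA ler_pdivrMr ?exprn_gt0.
pose n := Num.Def.archi_bound (`|B| / (a * (y - 1))).
have p0 : 0 < a * (y - 1) by rewrite mulr_gt0 // subr_gt0.
have : `|B| / (a * (y - 1)) < n%:R by rewrite archi_boundP // divr_ge0 // ltW.
rewrite ltr_pdivrMr // => hB.
have := hy n; have := ler_norm B.
have := ler_wpM2l (ltW a0) (bernoulli_ge n (ltW y1)); lra.
Qed.

Lemma le_of_le_geo (R : realType) (x y c : R) :
  (forall m, x <= y + c * 2^-1 ^+ m) -> x <= y.
Proof.
move=> h; rewrite -subr_le0 leNgt; apply/negP => xy.
have c0 : 0 <= c by have := h 0%N; rewrite expr0; lra.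
pose n := Num.Def.archi_bound (c / (x - y)).
have : c / (x - y) < n%:R by rewrite archi_boundP // divr_ge0 // ltW.
rewrite ltr_pdivrMr // => hn; have := h n; rewrite -lerBlDl exprVn ler_pdivlMr ?exprn_gt0 //.
have : n%:R <= 2 ^+ n :> R by rewrite -natrX ler_nat ltnW // ltn_expl.
by move=> h2; have := ler_wpM2r (ltW xy) h2; lra.
Qed.

Section Lipschitz1.
Variable R : realType.
Local Notation C := (Cplx R).

Lemma cderivative_differentiable (f : C -> C) (c d : C) :
  has_cderivative f c d -> differentiable f c.
Proof.
move=> fd; apply: (@nm_differentiable _ _ _ _ _ (fun h => d * h) (nm d)).
- by move=> a u v; rewrite mulrDr -scalerAr.
- by move=> h; rewrite nmM.
- move=> e /fd[r r0 hr]; exists r => // h hh.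
  by have := hr (c + h); rewrite addrAC subrr add0r; apply.
Qed.

(** [weak_max] is applied at [h] to $z((\phi(z)-\phi(0))/z)^n$. On the ring around [h] one has
    $|z|\ge\rho/2$, so the quotient is at most $2M/(\rho/2)=K$; the factors 5 and $3\rho$ do not
    depend on [n] and vanish in [le_of_pow_le]. *)
Lemma lipschitz_disc (phi : C -> C) (rho M : R) (h : C) : 0 < rho ->
  (forall z, nm z <= 3 * rho -> differentiable phi z /\ nm (phi z) <= M) ->
  nm h <= rho / 2 -> nm (phi h - phi 0) <= 4 * M / rho * nm h.
Proof.
move=> r0 phiP hr; have [->|h0] := eqVneq h 0; first by rewrite subrr nm0 mulr0.
have hp : 0 < nm h by rewrite nm_gt0.
rewrite -ler_pdivrMr //; have -> : nm (phi h - phi 0) / nm h = nm (diff_quot phi 0 h).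
  by rewrite /diff_quot subr0 nmM nmV.
set K := 4 * M / rho.
have M0 : 0 <= M.
  by apply: le_trans (nm_ge0 (phi 0)) (phiP 0 _).2; rewrite nm0 mulr_ge0 // ltW.
have K0 : 0 <= K by rewrite divr_ge0 ?mulr_ge0 // ltW.
apply: (@le_of_pow_le _ (nm h) (15 * rho)) => // n.
pose g z := z * diff_quot phi 0 z ^+ n.
rewrite -nmX -nmM -[h * _]/(g h) (_ : 15 * rho * _ = 5 * (3 * rho * K ^+ n)); last by ring.
apply: (weak_max r0) => z.
  move=> zh; have z3 : nm z <= 3 * rho.
    by have := nmD (z - h) h; rewrite subrK; lra.
  have -> : g = (fun z => (z - 0) * diff_quot phi 0 z ^+ n).
    by apply/funext => y; rewrite subr0.
  have [->|z0] := eqVneq z 0.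
    have [|d] := @cderivative_diff_quot_pow _ phi 0 n; last exact: cderivative_differentiable.
    by apply: (phiP 0 _).1; rewrite nm0 mulr_ge0 // ltW.
  exact: differentiable_diff_quot_pow z0 (phiP z z3).1.
move=> /andP[zh1 zh2]; have z3 : nm z <= 3 * rho.
  by have := nmD (z - h) h; rewrite subrK; lra.
have z1 : rho / 2 <= nm z by have := nmB z h; lra.
have zp : 0 < nm z by apply: lt_le_trans z1; rewrite divr_gt0.
rewrite /g nmM nmX; apply: ler_pM; rewrite ?nm_ge0 ?exprn_ge0 ?nm_ge0 //.
rewrite lerXn2r ?nnegrE ?nm_ge0 // /diff_quot subr0 nmM nmV ler_pdivrMr //.
have z00 : nm (0 : C) <= 3 * rho by rewrite nm0 mulr_ge0 // ltW.
apply: le_trans (nmB _ _) _; apply: le_trans (lerD (phiP z z3).2 (phiP 0 z00).2) _.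
have -> : M + M = K * (rho / 2) by rewrite /K; field; rewrite gt_eqF.
exact: ler_wpM2l.
Qed.

End Lipschitz1.

(** * Lipschitz and second-order Taylor estimates on balls *)

Section SeveralVariables.
Variables (R : realType) (V : normedModType (Cplx R)).
Local Notation C := (Cplx R).
Implicit Types (f : V -> C) (z v w : V).

Definition bounded_holo f z0 (r M : R) : Prop :=
  forall z, nm (z - z0) < r -> differentiable f z /\ nm (f z) <= M.

(** The disc estimate on the line $t\mapsto z+tv$, at $t=1$. The choice $3\rho|v|=r/2$ keeps the
    disc inside the ball, and $|v|\le r/12$ says that $1\le\rho/2$. *)
Lemma lipschitz_ball f z0 r M z v : 0 < r -> bounded_holo f z0 r M ->
  nm (z - z0) < r / 2 -> nm v <= r / 12 ->
  nm (f (z + v) - f z) <= 24 * M / r * nm v.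
Proof.
move=> r0 fb zr vr; have [->|v0] := eqVneq v 0.
  by rewrite addr0 subrr !nm0 mulr0.
have vp : 0 < nm v by rewrite nm_gt0.
pose phi (t : C) := f (z + t *: v); pose rho := r / (6 * nm v).
have rho0 : 0 < rho by rewrite divr_gt0 // mulr_gt0.
have := @lipschitz_disc R phi rho M 1 rho0; rewrite /phi scale1r scale0r addr0.
rewrite nm1 mulr1 (_ : 24 * M / r * nm v = 4 * M / rho); last first.
  by rewrite /rho; field; rewrite !gt_eqF.
apply=> [t ht|]; last by rewrite /rho -mulrA -invfM ler_pdivlMr ?mulr_gt0 //; lra.
have zt : nm (z + t *: v - z0) < r.
  rewrite addrAC; apply: le_lt_trans (nmD _ _) _; rewrite nmZ.
  have : nm t * nm v <= 3 * rho * nm v by rewrite ler_wpM2r // nm_ge0.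
  have -> : 3 * rho * nm v = r / 2 by rewrite /rho; field; rewrite !gt_eqF.
  lra.
have [fd fM] := fb _ zt; split=> //.
by apply: (@differentiable_comp _ _ _ _ (fun t : C => z + t *: v) f).
Qed.

Lemma le_mul_of_le_eps (x a b : R) : 0 <= b ->
  (forall e, 0 < e -> x <= a + e * b) -> x <= a.
Proof.
move=> b0 h; rewrite leNgt; apply/negP => ax; pose e := (x - a) / (2 * (b + 1)).
have b1 : 0 < 2 * (b + 1) by lra.
have e0 : 0 < e by rewrite divr_gt0 // subr_gt0.
have := h e e0; have : e * (2 * (b + 1)) = x - a by rewrite divfK // gt_eqF.
by have := mulr_ge0 (ltW e0) b0; lra.
Qed.

Lemma diff_bound f z0 r M z w : 0 < r -> bounded_holo f z0 r M ->
  nm (z - z0) < r / 2 -> nm ('d f z w : C) <= 24 * M / r * nm w.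
Proof.
move=> r0 fb zr; have [->|w0] := eqVneq w 0; first by rewrite linear0 !nm0 mulr0.
have wp : 0 < nm w by rewrite nm_gt0.
have [fz _] : differentiable f z /\ nm (f z) <= M by apply: fb; lra.
apply: (@le_mul_of_le_eps _ _ (nm w)) => [|e e0]; first exact: ltW.
have [s s0 hs] := differentiable_nm fz e0.
(* The vector $tw$ gets half the length that both the differentiability at [z] and [lipschitz_ball]
   allow. *)
pose t : R := Num.min s (r / 12) / (2 * nm w).
have m0 : 0 < Num.min s (r / 12) by rewrite lt_min s0 divr_gt0.
have t0 : 0 < t by rewrite divr_gt0 // mulr_gt0.
have tw : nm (real_complex R t *: w) = t * nm w by rewrite nmZ nm_real gtr0_norm.
have twE : t * nm w = Num.min s (r / 12) / 2 by rewrite /t; field; rewrite gt_eqF.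
have m1 : Num.min s (r / 12) <= s by rewrite ge_min lexx.
have m2 : Num.min s (r / 12) <= r / 12 by rewrite ge_min lexx orbT.
have h1 := hs (real_complex R t *: w) _.
rewrite tw in h1; have {}h1 := h1 ltac:(lra).
have := @lipschitz_ball f z0 r M z (real_complex R t *: w) r0 fb zr.
rewrite tw => h2; have {}h2 := h2 ltac:(lra).
move: h1 h2; rewrite linearZ; set D := 'd f z w.
set F := f _ - f z => h1 h2.
have : nm (real_complex R t * D : C) <= 24 * M / r * (t * nm w) + e * (t * nm w).
  by have := nmB F (F - real_complex R t * D); rewrite subKr -/F; move=> h; apply: le_trans h _; exact: lerD.
rewrite nmM nm_real gtr0_norm // => h; rewrite -(ler_pM2l t0).
by apply: le_trans h _; rewrite le_eqVlt; apply/orP; left; apply/eqP; ring.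
Qed.

(** Increments of [f] are again bounded and differentiable, with a bound proportional to $|v|$, so
    the Lipschitz estimate can be applied a second time. *)
Lemma bounded_holo_shift f z0 r M v : 0 < r -> bounded_holo f z0 r M ->
  nm v <= r / 12 ->
  bounded_holo (fun z => f (z + v) - f z) z0 (r / 2) (24 * M / r * nm v).
Proof.
move=> r0 fb vr z zr.
have zv : nm (z + v - z0) < r.
  by rewrite addrAC; apply: le_lt_trans (nmD _ _) _; lra.
split; last exact: (lipschitz_ball r0 fb).
apply: differentiableB; last by apply: (fb _ _).1; lra.
apply: (@differentiable_comp _ _ _ _ (fun z => z + v) f) => //.
exact: (fb _ zv).1.
Qed.

(** Along $w,w/2,w/4,\ldots$ the quadratic terms form a geometric series of sum at most $2A|w|^2$,
    and the leftover $2^n|E(w/2^n)|$ is small by the last hypothesis. *)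
Lemma halving_bound (E : V -> C) (A : R) (w : V) : 0 <= A ->
  (forall u, nm u <= nm w -> nm (E u) <= A * nm u ^+ 2 + 2 * nm (E (2^-1 *: u))) ->
  (forall e : R, 0 < e -> exists2 s : R, 0 < s &
    forall u, nm u < s -> nm (E u) <= e * nm u) ->
  nm (E w) <= 2 * A * nm w ^+ 2.
Proof.
move=> A0 hA ho; pose u n := 2^-1 ^+ n *: w.
have nu n : nm (u n) = 2^-1 ^+ n * nm w by rewrite nmZ nmX nm_half.
have g0 n : 0 <= 2^-1 ^+ n :> R by rewrite exprn_ge0.
have g1 n : 2^-1 ^+ n <= 1 :> R by rewrite exprn_ile1 // invf_le1 // ler1n.
have unw n : nm (u n) <= nm w by rewrite nu ler_piMl ?nm_ge0.
have hn n : nm (E w) <= 2 * A * nm w ^+ 2 * (1 - 2^-1 ^+ n) + 2 ^+ n * nm (E (u n)).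
  elim: n => [|n IH]; first by rewrite /u !expr0 scale1r subrr mulr0 add0r mul1r.
  apply: le_trans IH _; have := hA (u n) (unw n).
  have -> : 2^-1 *: u n = u n.+1 by rewrite /u scalerA -exprS.
  have p0 : 0 < 2 ^+ n :> R by rewrite exprn_gt0.
  move=> /(ler_wpM2l (ltW p0)); rewrite nu.
  have -> : 2 ^+ n * (A * (2^-1 ^+ n * nm w) ^+ 2 + 2 * nm (E (u n.+1))) =
     A * 2^-1 ^+ n * nm w ^+ 2 + 2 * 2 ^+ n * nm (E (u n.+1)).
    by rewrite exprVn; field; rewrite gt_eqF.
  rewrite (exprS 2) (exprS 2^-1); lra.
apply: (@le_mul_of_le_eps _ _ (nm w)) => [|e e0]; first exact: nm_ge0.
have [s s0 hs] := ho _ e0.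
have [n hns] : exists n, nm (u n) < s.
  exists (Num.Def.archi_bound (nm w / s)).
  rewrite nu exprVn mulrC ltr_pdivrMr ?exprn_gt0 // mulrC -ltr_pdivrMr //.
  apply: lt_le_trans (archi_boundP _) _; first by rewrite divr_ge0 ?nm_ge0 // ltW.
  by rewrite -natrX ler_nat ltnW // ltn_expl.
apply: le_trans (hn n) _.
have p0 : 0 < 2 ^+ n :> R by rewrite exprn_gt0.
have := ler_wpM2l (ltW p0) (hs _ hns); rewrite nu.
have -> : 2 ^+ n * (e * (2^-1 ^+ n * nm w)) = e * nm w.
  by rewrite exprVn; field; rewrite gt_eqF.
move=> h; apply: lerD h.
by rewrite mulrBr mulr1 gerBl !mulr_ge0 ?nm_ge0 ?g0.
Qed.

(** With $h=u/2$, the remainder at [u] is a second difference plus twice the remainder at [h]. The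
    second difference is quadratic in $|h|$, by the Lipschitz estimate for an increment. *)
Lemma taylor2 f z0 r M z w : 0 < r -> bounded_holo f z0 r M ->
  nm (z - z0) < r / 4 -> nm w <= r / 24 ->
  nm (f (z + w) - f z - 'd f z w) <= 576 * M / r ^+ 2 * nm w ^+ 2.
Proof.
move=> r0 fb zr wr.
have [fz fM] : differentiable f z /\ nm (f z) <= M by apply: fb; lra.
have M0 : 0 <= M by exact: le_trans (nm_ge0 _) fM.
(* The second difference is at most $24\cdot24\cdot2\,(M/r^2)|h|^2=288(M/r^2)|u|^2$; [halving_bound]
   doubles the constant. *)
rewrite (_ : 576 * M / r ^+ 2 = 2 * (288 * M / r ^+ 2)); last by ring.
apply: (@halving_bound (fun w => f (z + w) - f z - 'd f z w)).
- by apply: divr_ge0 (sqr_ge0 _); exact: mulr_ge0 (ler0n _ _) M0.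
- move=> u uw; pose h := 2^-1 *: u.
  have nh : nm h = nm u / 2 by rewrite nmZ nm_half mulrC.
  have hr : nm h <= r / 12 by rewrite nh; have := nm_ge0 u; lra.
  have r20 : 0 < r / 2 by rewrite divr_gt0.
  have hA : nm (f (z + h + h) - f (z + h) - (f (z + h) - f z)) <=
      24 * (24 * M / r * nm h) / (r / 2) * nm h.
    apply: (lipschitz_ball r20 (bounded_holo_shift r0 fb hr));
      rewrite ?nh; have := nm_ge0 u; lra.
  have uE : u = h + h by rewrite /h -scalerDl (_ : 2^-1 + 2^-1 = 1 :> C) ?scale1r //; field.
  rewrite -(addrA z) -uE nh in hA; rewrite (_ : 'd f z u = 'd f z h + 'd f z h); last by rewrite {1}uE linearD.
  set A := f (z + u) in hA *; set B := f (z + h) in hA *.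
  have -> : A - f z - ('d f z h + 'd f z h) =
    (A - B - (B - f z)) + 2 * (B - f z - 'd f z h) by ring.
  apply: le_trans (nmD _ _) _; rewrite nmM.
  have -> : nm (2 : C) = 2 by rewrite -(rmorph_nat (real_complex R)) nm_real normr_nat.
  rewrite lerD2r; apply: le_trans hA _.
  by rewrite le_eqVlt; apply/orP; left; apply/eqP; field; rewrite gt_eqF.
- by move=> e e0; exact: differentiable_nm.
Qed.

End SeveralVariables.

(** * Differentiability of the directional derivatives *)

Section DerivativeHolo.
Variables (R : realType).
Local Notation C := (Cplx R).

Lemma cauchy_geo (x : nat -> R) (K : R) :
  (forall m l, `|x m - x l| <= K * (2^-1 ^+ m + 2^-1 ^+ l)) ->
  exists y, forall m, `|x m - y| <= 3 * K * 2^-1 ^+ m.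
Proof.
move=> xc; have g0 n : 0 <= 2^-1 ^+ n :> R by rewrite exprn_ge0.
have K0 : 0 <= K.
  have := xc 0%N 0%N; rewrite subrr normr0 expr0 => h; lra.
have step m : `|x m - x m.+1| <= K * 2^-1 ^+ m * (3 / 2).
  by apply: le_trans (xc _ _) _; rewrite exprS; lra.
(* The intervals of radius $3K2^{-m}$ around the terms are nested: the radius halves at each step,
   and consecutive terms differ by at most half of it. *)
have [|||y hy] := @nested_intervals R (fun m => x m - 3 * K * 2^-1 ^+ m)
    (fun m => 6 * K * 2^-1 ^+ m).
- by move=> n; rewrite !mulr_ge0.
- by move=> n; have := step n; rewrite ler_norml => /andP[]; rewrite exprS; lra.
- by move=> n; have := step n; rewrite ler_norml => /andP[]; rewrite exprS; lra.
by exists y => m; have := hy m; rewrite ler_norml => /andP[]; lra.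
Qed.

Lemma cauchy_geoC (x : nat -> C) (K : R) :
  (forall m l, nm (x m - x l) <= K * (2^-1 ^+ m + 2^-1 ^+ l)) ->
  exists y, forall m, nm (x m - y) <= 6 * K * 2^-1 ^+ m.
Proof.
move=> xc.
have [a ha] : exists y, forall m, `|complex.Re (x m) - y| <= 3 * K * 2^-1 ^+ m.
  apply: cauchy_geo => m l; rewrite -(raddfB (@complex.Re R)).
  exact: le_trans (abs_Re_le_nm (x m - x l)) (xc m l).
have [b hb] : exists y, forall m, `|complex.Im (x m) - y| <= 3 * K * 2^-1 ^+ m.
  apply: cauchy_geo => m l; rewrite -(raddfB (@complex.Im R)).
  exact: le_trans (abs_Im_le_nm (x m - x l)) (xc m l).
exists (Complex a b) => m; apply: le_trans (nm_le_ReIm _) _.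
have := ha m; have := hb m; case: (x m) => ? ? /=; lra.
Qed.

Variable V : normedModType C.
Implicit Types (f : V -> C) (z v w : V).

Lemma bounded_holoZ f z0 r M (c : C) : bounded_holo f z0 r M ->
  bounded_holo (fun z => c * f z) z0 r (nm c * M).
Proof.
move=> fb z zr; have [fd fM] := fb z zr; split.
  by apply: differentiableM.
by rewrite nmM ler_wpM2l ?nm_ge0.
Qed.

(** The quotients [q m] approximate the derivative along [v] uniformly near [z0], up to $B2^{-m}$.
    Their differentials at [z] therefore converge to some [L], and the Taylor estimate for [q m],
    whose constant does not depend on [m], passes to the limit. *)
Lemma differentiable_derivative f z0 r M v z : 0 < r -> bounded_holo f z0 r M ->
  nm v <= r / 24 -> nm (z - z0) < r / 16 ->
  differentiable (fun z => 'd f z v : C) z.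
Proof.
move=> r0 fb vr zr.
have M0 : 0 <= M.
  by apply: le_trans (nm_ge0 (f z)) (fb z _).2; lra.
pose t (m : nat) : R := 2^-1 ^+ m; pose T m : C := real_complex R (t m).
have t0 m : 0 < t m by rewrite exprn_gt0.
have t1 m : t m <= 1 by rewrite exprn_ile1 // invf_le1 // ler1n.
have T0 m : T m != 0 by rewrite -nm_gt0 nm_real gtr0_norm.
have nT m : nm (T m) = t m by rewrite nm_real gtr0_norm.
have nTv m : nm (T m *: v) = t m * nm v by rewrite nmZ nT.
have tv m : t m * nm v <= nm v by rewrite ler_piMl ?nm_ge0.
pose q m y : C := (T m)^-1 * (f (y + T m *: v) - f y).
pose M1 := 24 * M / r * nm v.
have M10 : 0 <= M1.
  by apply: mulr_ge0 (nm_ge0 v); apply: divr_ge0 (ltW r0); exact: mulr_ge0 (ler0n _ _) M0.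
have qb m : bounded_holo (q m) z0 (r / 2) M1.
  have h : bounded_holo (fun y => f (y + T m *: v) - f y) z0 (r / 2)
      (24 * M / r * nm (T m *: v)).
    by apply: bounded_holo_shift => //; rewrite nTv; have := tv m; have := nm_ge0 v; lra.
  have := bounded_holoZ (T m)^-1 h.
  rewrite nmV nT nTv (_ : (t m)^-1 * _ = M1) //.
  by rewrite /M1; field; rewrite !gt_eqF.
pose B := 576 * M / r ^+ 2 * nm v ^+ 2.
have B0 : 0 <= B.
  by apply: mulr_ge0 (sqr_ge0 _); apply: divr_ge0 (sqr_ge0 _); exact: mulr_ge0 (ler0n _ _) M0.
have qf m y : nm (y - z0) < r / 4 -> nm (q m y - 'd f y v : C) <= B * t m.
  move=> yr; have := @taylor2 R V f z0 r M y (T m *: v) r0 fb yr.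
  rewrite nTv linearZ => h.
  have -> : q m y - 'd f y v = (T m)^-1 * (f (y + T m *: v) - f y - T m * 'd f y v).
    by rewrite /q [RHS]mulrBr mulKf.
  rewrite nmM nmV nT ler_pdivrMl //; apply: le_trans (h _) _.
    by have := tv m; have := nm_ge0 v; lra.
  by rewrite le_eqVlt; apply/orP; left; apply/eqP; rewrite /B; ring.
pose l m w : C := 'd (q m) z w.
have r2 : 0 < r / 2 by rewrite divr_gt0.
have r4 : 0 < r / 4 by rewrite divr_gt0.
pose K := 96 * B / r.
have K0 : 0 <= K by apply: divr_ge0 (ltW r0); exact: mulr_ge0 (ler0n _ _) B0.
have qd m : differentiable (q m) z by apply: (qb m z _).1; lra.
(* [q m] and [q k] approximate the same derivative, so their difference is at most
   $B(2^{-m}+2^{-k})$, and [diff_bound] carries this over to differentials. *)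
have lc w m k : nm (l m w - l k w) <= (K * nm w) * (t m + t k).
  have h : bounded_holo (fun y => q m y - q k y) z0 (r / 4) (B * t m + B * t k).
    move=> y yr; split.
      by apply: differentiableB; [apply: (qb m y _).1|apply: (qb k y _).1]; lra.
    rewrite (_ : _ - _ = (q m y - 'd f y v) - (q k y - 'd f y v)); last by ring.
    by apply: le_trans (nmB _ _) _; apply: lerD; exact: qf.
  have := @diff_bound R V _ z0 (r / 4) _ z w r4 h.
  rewrite (_ : 24 * (B * t m + B * t k) / (r / 4) * nm w = K * nm w * (t m + t k)); last first.
    by rewrite /K; field; rewrite gt_eqF.
  rewrite (_ : 'd (fun y => q m y - q k y) z w = l m w - l k w); last first.
    by rewrite (diffB (qd m) (qd k)).
  by apply; lra.
have /choice[L hL] w := @cauchy_geoC (l ^~ w) (K * nm w) (lc w).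
pose A := 576 * M1 / (r / 2) ^+ 2.
have A0 : 0 <= A by apply: divr_ge0 (sqr_ge0 _); exact: mulr_ge0 (ler0n _ _) M10.
have main w : nm w <= r / 48 ->
    nm ('d f (z + w) v - 'd f z v - L w : C) <= A * nm w ^+ 2.
  move=> wr; apply: (@le_of_le_geo _ _ _ (2 * B + 6 * (K * nm w))) => m.
  have zw : nm (z + w - z0) < r / 4.
    by rewrite addrAC; apply: le_lt_trans (nmD _ _) _; lra.
  have h1 := qf m (z + w) zw; have h2 : nm (q m z - 'd f z v : C) <= B * t m by apply: qf; lra.
  have h3 := hL w m.
  have h4 : nm (q m (z + w) - q m z - l m w) <= A * nm w ^+ 2.
    by apply: (@taylor2 R V (q m) z0 (r / 2) M1 z w r2 (qb m)); lra.
  set a1 : C := 'd f (z + w) v in h1 *; set a2 : C := 'd f z v in h2 *.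
  have -> : a1 - a2 - L w = (q m (z + w) - q m z - l m w) - (q m (z + w) - a1)
     + (q m z - a2) + (l m w - L w) by ring.
  set X := q m (z + w) - q m z - l m w in h4 *.
  set Y := q m (z + w) - a1 in h1 *; set Z := q m z - a2 in h2 *.
  set W := l m w - L w in h3 *.
  have := nmD (X - Y + Z) W; have := nmD (X - Y) Z; have := nmB X Y.
  rewrite -/(t m) in h3 *; lra.
have L0 (x : C) c : (forall m, nm x <= c * t m) -> x = 0.
  move=> h; apply/eqP; rewrite -nm_eq0 eq_le nm_ge0 andbT.
  by apply: (@le_of_le_geo _ _ _ c) => m; rewrite add0r; exact: h.
apply: (@nm_differentiable _ _ _ _ _ L (24 * M1 / (r / 2) + 6 * K)).
- move=> a u w; apply/subr0_eq.
  apply: (@L0 _ (6 * (K * nm (a *: u + w)) + nm a * (6 * (K * nm u)) + 6 * (K * nm w))) => m.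
  have h1 := hL (a *: u + w) m; have h2 := hL u m; have h3 := hL w m.
  have lE : l m (a *: u + w) = a * l m u + l m w by rewrite /l linearP.
  have -> : L (a *: u + w) - (a *: L u + L w) =
      a * (l m u - L u) + (l m w - L w) - (l m (a *: u + w) - L (a *: u + w)).
    by rewrite lE -[a *: L u]/(a * L u); ring.
  apply: le_trans (nmB _ _) _; apply: le_trans (lerD (nmD _ _) (lexx _)) _.
  rewrite nmM; have := ler_wpM2l (nm_ge0 a) h2; rewrite -!/(t m) in h1 h2 h3 *.
  lra.
- move=> w; have h := hL w 0%N.
  have lb : nm (l 0%N w) <= 24 * M1 / (r / 2) * nm w.
    by apply: (@diff_bound R V (q 0%N) z0 (r / 2) M1 z w r2 (qb 0%N)); lra.
  have := nmB (l 0%N w) (l 0%N w - L w); rewrite subKr; rewrite expr0 in h; lra.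
- move=> e e0; pose s := Num.min (r / 48) (e / (A + 1)).
  have A1 : 0 < A + 1 by rewrite ltr_wpDl.
  exists s; first by rewrite /s lt_min !divr_gt0.
  move=> w; rewrite lt_min => /andP[w1 w2]; apply: le_trans (main w (ltW w1)) _.
  rewrite expr2 mulrA ler_wpM2r ?nm_ge0 //.
  rewrite ltr_pdivlMr // in w2; have := nm_ge0 w; lra.
Qed.

End DerivativeHolo.

(** * Germs of functions and triangular Jacobian determinants *)

Section GermCalculus.
Variables (R : realType) (n : nat).
Local Notation C := (Cplx R).
Implicit Types (f g : func R n) (z w v : Cn R n).

Lemma differentiable_near_eq (V W : normedModType C) (f g : V -> W) (x : V) :
  (\forall y \near x, f y = g y) -> differentiable f x -> differentiable g x.
Proof.
move=> fg fx; have [k k0 hk] := linear_lipschitz (diff_continuous fx).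
have [r r0 hr] := (nearP_nm _ _).1 fg.
have fgx : f x = g x by apply: hr; rewrite subrr nm0.
apply: (@nm_differentiable _ _ _ _ _ ('d f x) (complex.Re k)).
- exact: linearP.
- move=> h; have := hk h; rewrite (_ : k = real_complex R (complex.Re k)).
    by rewrite !nmE -rmorphM lecR.
  by rewrite RRe_real // gtr0_real.
- move=> e e0; have [s s0 hs] := differentiable_nm fx e0.
  exists (Num.min r s); first by rewrite lt_min r0 s0.
  move=> h; rewrite lt_min => /andP[h1 h2]; rewrite -fgx -hr; first exact: hs.
  by rewrite addrAC subrr add0r.
Qed.

Lemma holo_germ_derive f v : holo_germ f -> holo_germ (fun z => 'D_v f z).
Proof.
move=> /nearP_nm[r1 r10 fd].
have f0 : differentiable f 0 by apply: fd; rewrite subrr nm0.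
have [r2 r20 fb] := nm_continuous (differentiable_continuous f0) ltr01.
pose r := Num.min r1 r2; have r0 : 0 < r by rewrite lt_min r10 r20.
have fh : bounded_holo f 0 r (nm (f 0) + 1).
  move=> z; rewrite lt_min => /andP[z1 z2]; split; first exact: fd.
  by have := fb z z2; have := nmD (f z - f 0) (f 0); rewrite subrK; lra.
(* [differentiable_derivative] asks for a short vector: [v] is scaled by [s], and the factor is
   removed by linearity. The summand 1 covers [v = 0]. *)
pose s : R := r / (24 * (nm v + 1)).
have v1 : 0 < 24 * (nm v + 1) by have := nm_ge0 v; lra.
have s0 : 0 < s by rewrite divr_gt0.
pose S : C := real_complex R s.
have S0 : S != 0 by rewrite -nm_gt0 nm_real gtr0_norm.
have sv : nm (S *: v) <= r / 24.
  rewrite nmZ nm_real gtr0_norm // /s mulrAC ler_pdivrMr //.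
  have := nm_ge0 v; have := mulr_ge0 (ltW r0) (nm_ge0 v); lra.
apply/nearP_nm; exists (r / 16); first by rewrite divr_gt0.
move=> z zr; have := differentiable_derivative r0 fh sv zr => dz.
apply: (@differentiable_near_eq _ _ (fun y => S^-1 * 'd f y (S *: v))); last first.
  exact: (@differentiableM _ _ (fun=> S^-1) _ z (differentiable_cst _ _) dz).
apply/nearP_nm; exists (r / 2); first by rewrite divr_gt0.
move=> y yz; have yr : nm (y - 0) < r.
  rewrite subr0 in zr; rewrite subr0; have := nmD (y - z) z; rewrite subrK.
  by move: zr yz r0; clear; lra.
have fy : differentiable f y by have [] := fh y yr.
by rewrite (deriveE v fy) linearZ; exact: (mulKf S0).
Qed.

(** Reduces a directional derivative to one variable, where only the values on a short line through
    [z] matter. *)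
Lemma derive_line (V W : normedModType C) (f : V -> W) (z v : V) :
  'D_v f z = 'D_1 (fun t : C => f (t *: v + z)) 0.
Proof.
have e (h : C) : h^-1 *: ((f \o shift z) (h *: v) - f z) =
    h^-1 *: (((fun t : C => f (t *: v + z)) \o shift 0) (h *: (1 : C)) -
             f (0 *: v + z)).
  by rewrite /= addr0 scale0r add0r -[h *: 1]/(h * 1) mulr1.
by rewrite /derive (funext e).
Qed.

(** The form of [depends_from] with one ball for both points, convenient for products and
    derivatives. *)
Definition depends_near (j : nat) f : Prop := exists2 r : R, 0 < r &
  forall z w, nm z < r -> nm w < r ->
    (forall i : 'I_n, (j <= i.+1)%N ->
       (z : 'rV[C]_n) 0 i = (w : 'rV[C]_n) 0 i) -> f z = f w.

Lemma depends_from_near j f : depends_from j f -> depends_near j f.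
Proof.
case=> -[A B] /= [/nearP_nm[r r0 hr] /nearP_nm[s s0 hs]] h.
exists (Num.min r s); first by rewrite lt_min r0 s0.
move=> z w; rewrite !lt_min => /andP[zr _] /andP[_ ws] e.
by apply: (h (z, w)) => //; split; [apply: hr|apply: hs]; rewrite subr0.
Qed.

Lemma line_near (V : normedModType C) (z v : V) (r : R) : nm z < r ->
  exists2 s : R, 0 < s & forall t : C, nm t < s -> nm (t *: v + z) < r.
Proof.
move=> zr; have v1 : 0 < nm v + 1 by have := nm_ge0 v; lra.
exists ((r - nm z) / (nm v + 1)); first by rewrite divr_gt0 // subr_gt0.
move=> t; rewrite ltr_pdivlMr // => ht; apply: le_lt_trans (nmD _ _) _.
by rewrite nmZ; have := nm_ge0 t; lra.
Qed.

Lemma depends_near_derive j f v : depends_near j f ->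
  depends_near j (fun z => 'D_v f z).
Proof.
move=> [r r0 h]; exists r; first exact: r0.
move=> z w zr wr zw; rewrite !(derive_line f); apply: near_eq_derive; apply/nearP_nm.
have [s s0 hs] := line_near v zr; have [s' s'0 hs'] := line_near v wr.
exists (Num.min s s'); first by rewrite lt_min s0 s'0.
move=> t; rewrite subr0 lt_min => /andP[t1 t2].
by apply: h; [exact: hs|exact: hs'|move=> i ji; rewrite !mxE zw].
Qed.

(** Along the coordinate [l] the function is locally constant. The ordinal [l] counts from 0 and [j]
    from 1. *)
Lemma depends_near_derive0 j f (l : 'I_n) : depends_near j f -> (l.+1 < j)%N ->
  \forall z \near (0 : Cn R n), 'D_(delta_mx 0 l : 'rV[C]_n) f z = 0.
Proof.
move=> [r r0 h] lj; apply/nearP_nm; exists r => // z; rewrite subr0 => zr.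
rewrite derive_line; transitivity ('D_1 (cst (f z) : C -> C) (0 : C)); last first.
  exact: derive_cst.
apply: near_eq_derive; apply/nearP_nm.
have [s s0 hs] := line_near (delta_mx 0 l : Cn R n) zr.
exists s => // t; rewrite subr0 => ts; apply: h => //; first exact: hs.
move=> i ji; rewrite !mxE eqxx /= (_ : (i == l) = false) ?mulr0 ?add0r //.
by apply/negbTE; apply: contraTneq ji => ->; rewrite -ltnNge.
Qed.

Lemma depends_nearM j f g : depends_near j f -> depends_near j g ->
  depends_near j (fun z => f z * g z).
Proof.
move=> [r r0 hf] [s s0 hg]; exists (Num.min r s); first by rewrite lt_min r0 s0.
move=> z w; rewrite !lt_min => /andP[z1 z2] /andP[w1 w2] zw.
by rewrite (hf z w) // (hg z w).
Qed.

Lemma depends_near_cst j (c : C) : depends_near j (fun=> c).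
Proof. by exists 1. Qed.

Lemma depends_near_prod j (r : seq nat) (F : nat -> func R n) :
  (forall i, i \in r -> depends_near j (F i)) ->
  depends_near j (fun z => \prod_(i <- r) F i z).
Proof.
elim: r => [|i r IH] h.
  have -> : (fun z => \prod_(i <- [::]) F i z) = (fun=> 1).
    by apply/funext => z; rewrite big_nil.
  exact: depends_near_cst.
have -> : (fun z => \prod_(i <- i :: r) F i z) =
    (fun z => F i z * \prod_(i <- r) F i z).
  by apply/funext => z; rewrite big_cons.
apply: depends_nearM; first by apply: h; rewrite mem_head.
by apply: IH => l lr; apply: h; rewrite in_cons lr orbT.
Qed.

Lemma depends_near_le i j f : (i <= j)%N -> depends_near j f -> depends_near i f.
Proof.
move=> ij [r r0 h]; exists r => // z w zr wr zw; apply: h => // l jl.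
by apply: zw; exact: leq_trans jl.
Qed.

Lemma holo_germM f g : holo_germ f -> holo_germ g -> holo_germ (fun z => f z * g z).
Proof.
by move=> hf hg; rewrite /holo_germ; near=> z; apply: differentiableM; near: z.
Unshelve. all: by end_near. Qed.

Lemma holo_germ_cst (c : C) : holo_germ (fun _ : Cn R n => c).
Proof. by apply: filterE => z; exact: differentiable_cst. Qed.

Lemma holo_germ_prod (r : seq nat) (F : nat -> func R n) :
  (forall i, i \in r -> holo_germ (F i)) ->
  holo_germ (fun z => \prod_(i <- r) F i z).
Proof.
elim: r => [|i r IH] h.
  have -> : (fun z => \prod_(i <- [::]) F i z) = (fun=> 1).
    by apply/funext => z; rewrite big_nil.
  exact: holo_germ_cst.
have -> : (fun z => \prod_(i <- i :: r) F i z) =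
    (fun z => F i z * \prod_(i <- r) F i z).
  by apply/funext => z; rewrite big_cons.
apply: holo_germM; first by apply: h; rewrite mem_head.
by apply: IH => l lr; apply: h; rewrite in_cons lr orbT.
Qed.

Lemma holo_germX f k : holo_germ f -> holo_germ (fun z => f z ^+ k).
Proof. by apply: filterS => z; exact: differentiable_exp. Qed.

Lemma holo_germ_neq0 f : holo_germ f -> f 0 != 0 ->
  \forall z \near (0 : Cn R n), f z != 0.
Proof.
move=> hf f0; have df := nbhs_singleton hf.
rewrite -nm_gt0 in f0.
have [r r0 hr] := nm_continuous (differentiable_continuous df) f0.
apply/nearP_nm; exists r => // z /hr; apply: contraTneq => ->.
by rewrite sub0r nmN ltxx.
Qed.

Lemma holo_germV f : holo_germ f -> f 0 != 0 -> holo_germ (fun z => (f z)^-1).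
Proof.
move=> hf f0; have nf := holo_germ_neq0 hf f0; rewrite /holo_germ; near=> z.
by apply: differentiableV; near: z.
Unshelve. all: by end_near. Qed.

Lemma diff_coord (l : 'I_n) (w v : Cn R n) :
  'd (fun y : Cn R n => (y : 'rV[C]_n) 0 l) w v = (v : 'rV[C]_n) 0 l.
Proof.
pose c (y : Cn R n) : C := (y : 'rV[C]_n) 0 l.
have lc : linear c by move=> a x y; rewrite /c !mxE.
pose L : {linear Cn R n -> C} := HB.pack c (GRing.isLinear.Build _ _ _ _ c lc).
have cL : continuous L by exact: (@coord_continuous C 1 n 0 l).
by rewrite -[LHS]/('d L w v) (diff_lin w cL).
Qed.

Variable G : Cn R n -> Cn R n.
Hypothesis hG : holo_map_germ G.

Lemma near_map (P : Cn R n -> Prop) :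
  (\forall w \near (0 : Cn R n), P w) -> \forall z \near (0 : Cn R n), P (G z).
Proof.
have [G0 dG] := hG.
have cG : G @ (0 : Cn R n) --> G 0 := differentiable_continuous (nbhs_singleton dG).
by rewrite G0 in cG => hP; exact: cG.
Qed.

Lemma holo_germ_comp f : holo_germ f -> holo_germ (f \o G).
Proof.
move=> /near_map hf; apply: filterS2 hf hG.2 => z fz Gz.
exact: (@differentiable_comp _ _ _ _ G f z Gz fz).
Qed.

Lemma jac_det_comp (H : 'I_n -> func R n) : (forall i, holo_germ (H i)) ->
  \forall z \near (0 : Cn R n), jac_det (fun i => H i \o G) z =
    \det (\matrix_(i < n, l < n) 'D_(delta_mx 0 l : 'rV[C]_n) (H i) (G z))
    * jac_det (component G) z.
Proof.
move=> hH; have dG := hG.2.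
have {}hH : \forall z \near (0 : Cn R n), forall i, differentiable (H i) (G z).
  apply: (@filter_forall _ 'I_n (fun i z => differentiable (H i) (G z)) _
    (nbhs_filter (0 : Cn R n))) => i.
  exact: (@near_map (fun w => differentiable (H i) w) (hH i)).
apply: filterS2 hH dG => z Hz Gz.
rewrite /jac_det -det_mulmx; congr (\det _); apply/matrixP => i j; rewrite !mxE.
rewrite deriveE; last exact: (@differentiable_comp _ _ _ _ G (H i) z Gz (Hz i)).
rewrite (@diff_comp _ _ _ _ G (H i) z Gz (Hz i)).
pose y : 'rV[C]_n := 'd G z (delta_mx 0 j : 'rV[C]_n).
pose L : {linear Cn R n -> C} := 'd (H i) (G z).
transitivity (L (\sum_(l < n) y 0 l *: (delta_mx 0 l : 'rV[C]_n))).
  by rewrite -(row_sum_delta y).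
transitivity (\sum_(l < n) L (y 0 l *: (delta_mx 0 l : 'rV[C]_n))).
  exact: (raddf_sum L).
apply: eq_bigr => l _; rewrite [X in _ = X * _]mxE [X in _ = _ * X]mxE.
transitivity (y 0 l * L (delta_mx 0 l : 'rV[C]_n)); first exact: (linearZ_LR L).
rewrite mulrC (deriveE _ (Hz i)); congr (_ * _).
have cl : differentiable (fun y : Cn R n => (y : 'rV[C]_n) 0 l) (G z).
  exact: differentiable_coord.
rewrite deriveE; last exact: (@differentiable_comp _ _ _ _ G _ z Gz cl).
rewrite (@diff_comp _ _ _ _ G _ z Gz cl).
by rewrite /= diff_coord.
Qed.

Lemma det_upper_triangular (A : 'M[C]_n) :
  (forall i l : 'I_n, (l < i)%N -> A i l = 0) -> \det A = \prod_(i < n) A i i.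
Proof.
move=> h; rewrite -det_tr det_trig.
  by apply: eq_bigr => i _; rewrite mxE.
by apply/is_trig_mxP => i l il; rewrite mxE h.
Qed.

(** [H i] depends only on the coordinates from its own on, so the matrix of its derivatives is upper
    triangular; the chain rule splits off the Jacobian of [G]. *)
Lemma jac_det_comp_triangular (H d : 'I_n -> func R n) :
  (forall i, holo_germ (H i)) -> (forall i : 'I_n, depends_near i.+1 (H i)) ->
  (forall i : 'I_n, \forall w \near (0 : Cn R n),
     'D_(delta_mx 0 i : 'rV[C]_n) (H i) w = d i w) ->
  germ_eq (jac_det (fun i => H i \o G))
    (fun z => (\prod_(i < n) d i (G z)) * jac_det (component G) z).
Proof.
move=> hH dH Dd.
have Dd' : \forall z \near (0 : Cn R n), forall i : 'I_n,
    'D_(delta_mx 0 i : 'rV[C]_n) (H i) (G z) = d i (G z).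
  apply: (@filter_forall _ 'I_n (fun (i : 'I_n) z =>
    'D_(delta_mx 0 i : 'rV[C]_n) (H i) (G z) = d i (G z)) _
    (nbhs_filter (0 : Cn R n))) => i.
  exact: (@near_map (fun w => 'D_(delta_mx 0 i : 'rV[C]_n) (H i) w = d i w) (Dd i)).
have D0 : \forall z \near (0 : Cn R n), forall i l : 'I_n, (l < i)%N ->
    'D_(delta_mx 0 l : 'rV[C]_n) (H i) (G z) = 0.
  apply: (@filter_forall _ 'I_n (fun (i : 'I_n) z => forall l : 'I_n, (l < i)%N ->
    'D_(delta_mx 0 l : 'rV[C]_n) (H i) (G z) = 0) _
    (nbhs_filter (0 : Cn R n))) => i.
  apply: (@filter_forall _ 'I_n (fun (l : 'I_n) z => (l < i)%N ->
    'D_(delta_mx 0 l : 'rV[C]_n) (H i) (G z) = 0) _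
    (nbhs_filter (0 : Cn R n))) => l.
  have [li|il] := ltnP l i; last by apply: filterE => z.
  have h := @depends_near_derive0 i.+1 (H i) l (dH i) li.
  have := @near_map (fun w => 'D_(delta_mx 0 l : 'rV[C]_n) (H i) w = 0) h.
  by apply: filterS => z hz _.
apply: filterS3 (jac_det_comp hH) Dd' D0 => z -> e1 e0.
congr (_ * _); rewrite det_upper_triangular => [|i l li]; last by rewrite mxE e0.
by apply: eq_bigr => i _; rewrite mxE e1.
Qed.

End GermCalculus.

(** * One round of Kohn's procedures and its iteration over multi-indices *)

Section KohnStep.
Variables (R : realType) (n : nat).
Local Notation C := (Cplx R).

Lemma unit_vecE (l : 'I_n) : unit_vec R n l.+1 = (delta_mx 0 l : 'rV[C]_n).
Proof. by apply/rowP => i; rewrite !mxE eqxx /= eqSS. Qed.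

Definition pder (j : nat) (f : func R n) : func R n :=
  fun z => 'D_(unit_vec R n j) f z.

(** Turns the one-variable derivatives that define the vanishing order into iterated partial
    derivatives. *)
Lemma derive1n_line j (f : func R n) a :
  derive1n a (fun t : C => f (t *: unit_vec R n j)) =
  (fun t => iter a (pder j) f (t *: unit_vec R n j)).
Proof.
elim: a => [//|a IH]; rewrite derive1nS IH; apply/funext => t.
rewrite /= /derive1 /pder /derive; set v := unit_vec R n j.
have e (h : C) : h^-1 *: (iter a (pder j) f ((h + t) *: v) - iter a (pder j) f (t *: v))
   = h^-1 *: ((iter a (pder j) f \o shift (t *: v)) (h *: v) - iter a (pder j) f (t *: v)).
  by rewrite /= scalerDl.
by rewrite (funext e).
Qed.

Lemma order_in_neq0 j (f : func R n) d :
  order_in j f (Some d) -> iter d (pder j) f 0 != 0.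
Proof. by case=> _; rewrite derive1n_line scale0r => /eqP. Qed.

Lemma germ_eq_refl (f : func R n) : germ_eq f f.
Proof. exact: filterE. Qed.

Variables (k : nat) (G : Cn R n -> Cn R n) (Q : nat -> func R n) (m : nat -> nat).
Hypotheses (kn : (k < n)%N) (hG : holo_map_germ G).
Hypothesis Qholo : forall i, (1 <= i <= k.+1)%N -> holo_germ (Q i).
Hypothesis Qdep : forall i, (1 <= i <= k.+1)%N -> depends_near i (Q i).

Definition dQ (i c : nat) : func R n := iter c (pder i) (Q i).

Hypothesis dQ_unit : forall i, (1 <= i <= k)%N -> dQ i (m i) 0 != 0.

Lemma dQ_holo i c : (1 <= i <= k)%N -> holo_germ (dQ i c).
Proof.
move=> /andP[i1 ik]; elim: c => [|c IH]; last exact: holo_germ_derive.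
by apply: Qholo; rewrite i1 leqW.
Qed.

Lemma dQ_dep i c : (1 <= i <= k)%N -> depends_near i (dQ i c).
Proof.
move=> /andP[i1 ik]; elim: c => [|c IH]; last exact: depends_near_derive.
by apply: Qdep; rewrite i1 leqW.
Qed.

(* The derivative of top order m i is a unit, and is replaced by 1. *)
Definition dQ_red (i c : nat) : func R n := if c == m i then fun=> 1 else dQ i c.

Lemma dQ_red_holo i c : (1 <= i <= k)%N -> holo_germ (dQ_red i c).
Proof.
move=> ik; rewrite /dQ_red; case: eqP => _; last exact: dQ_holo.
exact: holo_germ_cst.
Qed.

Lemma dQ_red_dep i c : (1 <= i <= k)%N -> depends_near i (dQ_red i c).
Proof.
move=> ik; rewrite /dQ_red; case: eqP => _; last exact: dQ_dep.
exact: depends_near_cst.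
Qed.

(** [tail a 0] composed with [G] is $g_a$ up to a unit, and [tail a k] is $Q_{k+1}$. In between, the
    entries up to [j] count as having reached their top order. *)
Definition tail (a : nat -> nat) (j : nat) : func R n :=
  fun w => Q k.+1 w * \prod_(j.+1 <= l < k.+1) dQ_red l (a l) w.

Lemma tail_holo a j : holo_germ (tail a j).
Proof.
apply: holo_germM; first by apply: Qholo; rewrite leqnn.
apply: (@holo_germ_prod _ _ _ (fun l => dQ_red l (a l))) => l.
rewrite mem_index_iota ltnS => /andP[jl lk]; apply: dQ_red_holo.
by rewrite lk (leq_trans _ jl).
Qed.

Lemma tail_dep a j : (j <= k)%N -> depends_near j.+1 (tail a j).
Proof.
move=> jk; apply: depends_nearM.
  by apply: (@depends_near_le _ _ _ k.+1) => //; apply: Qdep; rewrite leqnn.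
apply: (@depends_near_prod _ _ _ _ (fun l => dQ_red l (a l))) => l.
rewrite mem_index_iota ltnS => /andP[jl lk]; apply: (depends_near_le jl).
by apply: dQ_red_dep; rewrite lk (leq_trans _ jl).
Qed.

Definition coef (a : nat -> nat) (i : nat) : func R n :=
  if a i == 1%N then fun=> 1 else tail a i.

(** The function put into slot [i] for (P1). As [coef] involves later coordinates only,
    differentiation in $w_i$ just raises the order [(a i).-1] to [a i]. *)
Definition slot (a : nat -> nat) (i : nat) : func R n :=
  fun w => coef a i w * dQ i (a i).-1 w.

Lemma coef_holo a i : holo_germ (coef a i).
Proof.
by rewrite /coef; case: eqP => _; [exact: holo_germ_cst|exact: tail_holo].
Qed.

Lemma coef_dep a i : (i <= k)%N -> depends_near i.+1 (coef a i).
Proof.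
move=> ik; rewrite /coef; case: eqP => _; first exact: depends_near_cst.
exact: tail_dep.
Qed.

Lemma slot_holo a i : (1 <= i <= k)%N -> holo_germ (slot a i).
Proof. by move=> ik; apply: holo_germM; [exact: coef_holo|exact: dQ_holo]. Qed.

Lemma slot_dep a i : (1 <= i <= k)%N -> depends_near i (slot a i).
Proof.
move=> /andP[i1 ik]; apply: depends_nearM; last by apply: dQ_dep; rewrite i1.
by apply: (@depends_near_le _ _ _ i.+1) => //; exact: coef_dep.
Qed.

Lemma derive_slot a (l : 'I_n) : (l < k)%N -> (1 <= a l.+1)%N ->
  \forall w \near (0 : Cn R n), 'D_(delta_mx 0 l : 'rV[C]_n) (slot a l.+1) w =
    coef a l.+1 w * dQ l.+1 (a l.+1) w.
Proof.
move=> lk a1; have lk' : (1 <= l.+1 <= k)%N by [].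
have c0 := depends_near_derive0 (l := l) (coef_dep a lk) (ltnSn _).
apply: filterS3 c0 (coef_holo a l.+1) (dQ_holo (a l.+1).-1 lk') => w c0 dc diff_quot.
rewrite deriveM; [|exact: diff_derivable|exact: diff_derivable].
rewrite c0 scaler0 addr0; congr (_ * _).
by rewrite -{2}(prednK a1) /= /pder unit_vecE.
Qed.

(** Beyond the first [k] slots come coordinate functions: composed with [G] they are the
    pre-multipliers $\Gamma_{k+1},\ldots,\Gamma_n$, and they contribute the factor 1 to the
    determinant. *)
Definition column (a : nat -> nat) (l : 'I_n) : func R n :=
  if (l < k)%N then slot a l.+1 else fun w => (w : 'rV[C]_n) 0 l.

Lemma jac_det_column a : (forall i, (1 <= i <= k)%N -> (1 <= a i)%N) ->
  germ_eq (jac_det (fun l => column a l \o G))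
    (fun z => (\prod_(1 <= i < k.+1) (coef a i (G z) * dQ i (a i) (G z)))
              * jac_det (component G) z).
Proof.
move=> a1; pose d (l : 'I_n) : func R n := if (l < k)%N then
  (fun w => coef a l.+1 w * dQ l.+1 (a l.+1) w) else (fun=> 1).
have coordh (l : 'I_n) : holo_germ (fun w : Cn R n => (w : 'rV[C]_n) 0 l).
  by apply: filterE => w; exact: differentiable_coord.
have h1 l : holo_germ (column a l).
  by rewrite /column; case: ifP => lk; [exact: slot_holo|exact: coordh].
have h2 (l : 'I_n) : depends_near l.+1 (column a l).
  rewrite /column; case: ifP => lk; first exact: slot_dep.
  by exists 1 => // z w _ _ zw; apply: zw.
have h3 (l : 'I_n) : \forall w \near (0 : Cn R n),
    'D_(delta_mx 0 l : 'rV[C]_n) (column a l) w = d l w.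
  rewrite /column /d; case: ifP => lk; first by apply: derive_slot => //; exact: a1.
  apply: filterS (coordh l) => w dw.
  by rewrite deriveE // diff_coord mxE !eqxx.
apply: filterS (jac_det_comp_triangular hG h1 h2 h3) => z ->; congr (_ * _).
rewrite big_add1 big_mkord (big_ord_widen n (fun i : nat =>
  coef a i.+1 (G z) * dQ i.+1 (a i.+1) (G z)) (ltnW kn)) [RHS]big_mkcond /=.
by apply: eq_bigr => l _; rewrite /d; case: ifP.
Qed.

Definition topunit (a : nat -> nat) (i : nat) : func R n :=
  if a i == m i then dQ i (m i) else fun=> 1.

(** What remains of [tail a 0] when the [i]-th diagonal entry, freed of its unit [topunit a i], is
    divided out; see [tail_split]. *)
Definition cofactor_coef (a : nat -> nat) (i : nat) : func R n :=
  fun w => (\prod_(1 <= l < i) dQ_red l (a l) w) *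
           (if a i == 1%N then tail a i w else 1).

Lemma tail_split a i w : (1 <= i <= k)%N ->
  cofactor_coef a i w * coef a i w * dQ_red i (a i) w = tail a 0 w.
Proof.
move=> /andP[i1 ik].
have -> : tail a 0 w = (\prod_(1 <= l < i) dQ_red l (a l) w) * (dQ_red i (a i) w * tail a i w).
  have ikS : (i < k.+1)%N by [].
  rewrite /tail (@big_cat_nat _ _ _ i 1 k.+1 xpredT _ i1 (ltnW ikS)) /=.
  by rewrite (@big_ltn _ _ _ i k.+1) //; ring.
by rewrite /cofactor_coef /coef; case: eqP => _; ring.
Qed.

Lemma dQ_topunit a i w : dQ i (a i) w = topunit a i w * dQ_red i (a i) w.
Proof. by rewrite /topunit /dQ_red; case: eqP => [->|_]; rewrite ?mulr1 ?mul1r. Qed.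

Lemma topunit_holo a i : (1 <= i <= k)%N -> holo_germ (topunit a i).
Proof.
by rewrite /topunit; case: eqP => _ ik; [exact: dQ_holo|exact: holo_germ_cst].
Qed.

Lemma topunit0 a i : (1 <= i <= k)%N -> topunit a i 0 != 0.
Proof.
by rewrite /topunit; case: (a i =P m i) => _ ik; [exact: dQ_unit|exact: oner_neq0].
Qed.

(** Of the [k + 1] factors [tail a 0], [k] are divided by the [k] nontrivial diagonal entries of the
    triangular Jacobian, and the last one contributes $Q_{k+1}\circ\Gamma=f+cJ$. The diagonal
    entries and $J$ together form the Jacobian determinant of the slots. *)
Lemma tail_pow a (f c : func R n) : (forall i, (1 <= i <= k)%N -> (1 <= a i)%N) ->
  holo_germ c ->
  germ_eq (Q k.+1 \o G) (fun z => f z + c z * jac_det (component G) z) ->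
  exists c0 c1 : func R n, [/\ holo_germ c0, holo_germ c1 &
    germ_eq (fun z => tail a 0 (G z) ^+ k.+1)
      (fun z => c0 z * f z + c1 z * jac_det (fun l => column a l \o G) z)].
Proof.
move=> a1 ch Qfc.
pose e w := \prod_(1 <= l < k.+1) dQ_red l (a l) w.
have eh : holo_germ e.
  apply: (@holo_germ_prod _ _ _ (fun l => dQ_red l (a l))) => l.
  by rewrite mem_index_iota ltnS; exact: dQ_red_holo.
(* [b] multiplies the quotients of [tail a 0] by the diagonal entries; the units are invertible at
   0, so it is holomorphic. *)
pose b w := \prod_(1 <= i < k.+1) (cofactor_coef a i w * (topunit a i w)^-1).
have bh : holo_germ b.
  apply: (@holo_germ_prod _ _ _
    (fun i w => cofactor_coef a i w * (topunit a i w)^-1)) => i.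
  rewrite mem_index_iota ltnS => ik; apply: holo_germM; last first.
    by apply: holo_germV; [exact: topunit_holo|exact: topunit0].
  apply: holo_germM.
    apply: (@holo_germ_prod _ _ _ (fun l => dQ_red l (a l))) => l.
    rewrite mem_index_iota => /andP[l1 li]; apply: dQ_red_holo.
    by rewrite l1 ltnW // (leq_trans li) //; case/andP: ik.
  by case: (a i == 1%N); [exact: tail_holo|exact: holo_germ_cst].
exists (fun z => tail a 0 (G z) ^+ k * e (G z)), (fun z => b (G z) * e (G z) * c z).
split.
- apply: (holo_germ_comp hG (f := fun w => tail a 0 w ^+ k * e w)).
  by apply: holo_germM => //; apply: holo_germX; exact: tail_holo.
- apply: holo_germM => //; apply: (holo_germ_comp hG (f := fun w => b w * e w)).
  exact: holo_germM.
have un0 : \forall z \near (0 : Cn R n), forall i : 'I_k, topunit a i.+1 (G z) != 0.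
  apply: (@filter_forall _ 'I_k (fun (i : 'I_k) z => topunit a i.+1 (G z) != 0) _
    (nbhs_filter (0 : Cn R n))) => i.
  have ik : (1 <= i.+1 <= k)%N := ltn_ord i.
  exact: (near_map hG (holo_germ_neq0 (topunit_holo a ik) (topunit0 a ik))).
apply: filterS3 Qfc (jac_det_column a1) un0 => z Qz -> un.
have bE : b (G z) * (\prod_(1 <= i < k.+1) (coef a i (G z) * dQ i (a i) (G z)))
    = tail a 0 (G z) ^+ k.
  rewrite -big_split /= (eq_big_nat _ _ (F2 := fun=> tail a 0 (G z))).
    by rewrite prodr_const_nat subn1.
  move=> [//|i] /andP[_ ik]; rewrite -(tail_split a (G z) (i := i.+1)) //.
  rewrite dQ_topunit; have u0 : topunit a i.+1 (G z) != 0 := un (@Ordinal k i ik).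
  by field.
rewrite exprSr -bE [in LHS]/tail /= -/(e (G z)).
rewrite -[Q k.+1 (G z)]/((Q k.+1 \o G) z) Qz /=.
by ring.
Qed.

Variables (Ik : set (func R n)) (f c : func R n).
Hypotheses (Ikf : Ik f) (ch : holo_germ c).
Hypothesis Qfc :
  germ_eq (Q k.+1 \o G) (fun z => f z + c z * jac_det (component G) z).
Hypothesis IkQ : forall i, (1 <= i <= k)%N -> Ik (Q i \o G).

Local Notation generates := (kohn_generates (last_components k G) k.+1 Ik).

Lemma kohn_generates_sub p q M : generates p q M -> Ik `<=` M.
Proof.
by elim=> [//|p' q' M' g _ IH _|p' q' M' r g _ IH _ _] h Ih; left; exact: IH.
Qed.

(** (P1) produces the Jacobian determinant of the slots, and (P2), with this determinant and [f] as
    generators and root order [k + 1], produces [tail a 0 \o G]. *)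
Lemma kohn_step a M p q : (forall i, (1 <= i <= k)%N -> (1 <= a i)%N) ->
  generates p q M -> (forall i, (1 <= i <= k)%N -> M (slot a i \o G)) ->
  exists M', [/\ generates p.+1 q.+1 M', M `<=` M' & M' (tail a 0 \o G)].
Proof.
move=> a1 gM slotM.
have [c0 [c1 [c0h c1h e]]] := tail_pow a1 ch Qfc.
set J := jac_det _ in e.
have P1 : kohn_P1 (last_components k G) M J.
  exists (fun l => column a l \o G); last exact: germ_eq_refl.
  move=> l; rewrite /column; case: ifP => lk; first by right; exact: slotM.
  left; exists l; last exact: germ_eq_refl.
  by rewrite ltnS leqNgt lk.
have g1 := kohn_apply_P1 gM P1.
have P2 : kohn_P2 (M `|` germ J) k.+1 (tail a 0 \o G).
  split=> //; first by apply: (holo_germ_comp hG); exact: tail_holo.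
  exists 2%N, (fun i : 'I_2 => if i == ord0 then f else J); split => //.
    move=> i; case: (i == ord0); last by right; exact: germ_eq_refl.
    by left; exact: (kohn_generates_sub gM).
  exists (fun i : 'I_2 => if i == ord0 then c0 else c1).
    by move=> i; case: (i == ord0).
  apply: filterS e => z; rewrite /= => ->.
  by rewrite big_ord_recl big_ord1.
exists (M `|` germ J `|` germ (tail a 0 \o G)); split.
- exact: kohn_apply_P2 g1 (leqnn _) P2.
- by move=> h Mh; left; left.
- by right; exact: germ_eq_refl.
Qed.

(** Ensures that slots already available stay available when lower entries of the multi-index
    change. *)
Lemma eq_slot a b i : (forall l, (i <= l)%N -> a l = b l) -> slot a i = slot b i.
Proof.
move=> ab; apply/funext => w; rewrite /slot /coef ab //; congr (_ * _).
case: (b i == 1%N) => //; rewrite /tail; congr (_ * _).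
by apply: eq_big_nat => l /andP[il _]; rewrite ab // ltnW.
Qed.

Definition upd (a : nat -> nat) (i c : nat) (l : nat) : nat :=
  if l == i then c else a l.

Lemma slot_first a i : a i = 1%N -> slot a i = Q i.
Proof. by move=> ai; apply/funext => w; rewrite /slot /coef ai eqxx mul1r. Qed.

(** The slot for order [d + 1] is the multiplier reached for order [d] once the lower entries have
    been run through; $d<m_i$ keeps its [i]-th factor from being replaced by 1. *)
Lemma slot_succ a i d : (1 <= i <= k)%N -> (0 < d < m i)%N ->
  slot (upd a i d.+1) i = tail (upd a i d) i.-1.
Proof.
case: i => [//|i] ik /andP[d0 dm]; apply/funext => w.
rewrite /slot /coef /upd eqxx eqSS eqn0Ngt d0 /= /tail.
rewrite (@big_ltn _ _ _ i.+1 k.+1) ?ltnS ?(andP ik).2 // eqxx.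
rewrite {2}/dQ_red (ltn_eqF dm) /= [RHS]mulrCA [RHS]mulrC; congr (_ * _ * _).
by apply: eq_big_nat => l /andP[il _]; rewrite !(gtn_eqF il).
Qed.

(** At top order the [i]-th factor is replaced by 1, so a completed loop over entry [i] yields the
    shorter product. *)
Lemma tail_last a i : (1 <= i <= k)%N -> tail (upd a i (m i)) i.-1 = tail a i.
Proof.
case: i => [//|i] ik; apply/funext => w; rewrite /tail /=.
rewrite (@big_ltn _ _ _ i.+1 k.+1) ?ltnS ?(andP ik).2 // /upd eqxx.
rewrite {1}/dQ_red eqxx mul1r; congr (_ * _).
by apply: eq_big_nat => l /andP[il _]; rewrite (gtn_eqF il).
Qed.

Hypothesis m_gt0 : forall i, (1 <= i <= k)%N -> (0 < m i)%N.

(* The multi-indices are run through in lexicographic order, the last entry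
   being the most significant one: the entries below or at j vary first. *)
Lemma kohn_iterate j a M p q : (j <= k)%N ->
  (forall i, (j < i <= k)%N -> (1 <= a i)%N) ->
  generates p q M -> (forall i, (j < i <= k)%N -> M (slot a i \o G)) ->
  let N := (\prod_(1 <= i < j.+1) m i)%N in
  exists M', [/\ generates (p + N) (q + N) M', M `<=` M' & M' (tail a j \o G)].
Proof.
elim: j a M p q => [|j IH] a M p q jk a1 gM slotM N.
  by rewrite /N big_geq // !addn1; exact: kohn_step.
pose N' := (\prod_(1 <= i < j.+1) m i)%N.
have jk' : (1 <= j.+1 <= k)%N by [].
(* After [d] rounds, of [N'] applications of each procedure, entry [j + 1] has been raised to [d].
   For [d = 0] nothing has been produced yet, hence the guard. *)
suff loop d : (d <= m j.+1)%N -> exists M',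
    [/\ generates (p + d * N') (q + d * N') M', M `<=` M' &
        (0 < d)%N -> M' (tail (upd a j.+1 d) j \o G)].
  have [M' [gM' MM' tM']] := loop (m j.+1) (leqnn _).
  exists M'; split=> //.
    by rewrite /N big_nat_recr //= mulnC.
  by have := tM' (m_gt0 jk'); rewrite (tail_last a jk').
elim: d => [_|d IHd dm]; first by exists M; rewrite !mul0n !addn0; split.
have [M1 [gM1 MM1 tM1]] := IHd (ltnW dm).
have slot1 i : (j < i <= k)%N -> M1 (slot (upd a j.+1 d.+1) i \o G).
  move=> /andP[ji ik]; have [->|ij] := eqVneq i j.+1.
    (* Order 1 starts from $Q_{j+1}\circ\Gamma\in I_k$; higher orders use the multiplier of the
       preceding round. *)
    have [d0|d0] := posnP d; last first.
      by rewrite slot_succ ?d0 //; exact: tM1.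
    rewrite slot_first; last by rewrite /upd eqxx d0.
    by apply: (kohn_generates_sub gM1); exact: IkQ.
  have ji' : (j.+1 < i)%N by rewrite ltn_neqAle eq_sym ij.
  apply: MM1; rewrite (@eq_slot _ a); first by apply: slotM; rewrite ji' ik.
  by move=> l il; rewrite /upd gtn_eqF // (leq_trans ji').
have u1 i : (j < i <= k)%N -> (1 <= upd a j.+1 d.+1 i)%N.
  move=> /andP[ji ik]; rewrite /upd; case: eqP => // /eqP ij; apply: a1.
  by rewrite ik ltn_neqAle eq_sym ij ji.
have [M' [gM' M1M' tM']] := IH _ _ _ _ (ltnW jk) u1 gM1 slot1.
exists M'; split => //; last by apply: subset_trans M1M'.
by rewrite !mulSn (addnC N') !addnA.
Qed.

End KohnStep.

(** * Orders of the multipliers and the conclusion *)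

Section KohnOrders.
Variables (R : realType) (n : nat).

(** Each (P1) halves the order and each (P2) divides it by at most [rmax]; earlier multipliers are
    kept by lowering their bound. *)
Lemma kohn_closed_generates (P A M' : set (func R n)) (M : R -> set (func R n))
    (eps : R) rmax p q :
  kohn_closed P M -> 0 < eps <= 1 / 2 -> A `<=` M eps ->
  kohn_generates P rmax A p q M' -> (0 < rmax)%N ->
  M' `<=` M (eps / (2 ^+ p * rmax%:R ^+ q)).
Proof.
move=> Mc /andP[e0 e2] AM gM r0.
have rp : 0 < rmax%:R :> R by rewrite ltr0n.
have r1 : 1 <= rmax%:R :> R by rewrite ler1n.
(* The current order stays in $(0,1/2]$, as both procedures demand. *)
have bound i j : 0 < eps / (2 ^+ i * rmax%:R ^+ j) <= 1 / 2.
  have d0 : 0 < 2 ^+ i * rmax%:R ^+ j :> R by rewrite mulr_gt0 ?exprn_gt0.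
  rewrite divr_gt0 //=; apply: le_trans e2; rewrite ler_pdivrMr // ler_peMr ?(ltW e0) //.
  by apply: mulr_ege1; apply: exprn_ege1; rewrite // ler1n.
elim: gM => {p q M'} [|p q M' g gM' IH P1|p q M' r g gM' IH rr P2].
- by rewrite !expr0 mulr1 divr1.
- set d := eps / _ in IH; have /andP[d0 d2] := bound p q.
  have -> : eps / (2 ^+ p.+1 * rmax%:R ^+ q) = d / 2.
    by rewrite /d exprS; field; rewrite !expf_neq0 // gt_eqF.
  move=> h [/IH Mh|gh].
    by apply: (kohn_closed_le Mc _ Mh); rewrite divr_gt0 //= ler_pdivrMr // ler_peMr ?ler1n // ltW.
  apply: (kohn_closed_germ Mc gh); apply: (kohn_closed_P1 Mc); first exact: bound.
  by case: P1 => F FP gF; exists F => // i; case: (FP i) => [|/IH]; [left|right].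
- set d := eps / _ in IH; have /andP[d0 d2] := bound p q.
  have -> : eps / (2 ^+ p * rmax%:R ^+ q.+1) = d / rmax%:R.
    by rewrite /d exprS; field; rewrite !expf_neq0 // gt_eqF.
  move=> h [/IH Mh|gh].
    apply: (kohn_closed_le Mc _ Mh); rewrite divr_gt0 //=.
    by rewrite ler_pdivrMr // ler_peMr // ltW.
  apply: (kohn_closed_germ Mc gh).
  case: P2 => r1' gholo [s [F [s1 FM gF]]].
  have rp' : 0 < r%:R :> R by rewrite ltr0n.
  apply: (kohn_closed_le Mc (eps := d / r%:R)).
    by rewrite divr_gt0 //= ler_pM2l // lef_pV2 ?posrE // ler_nat.
  apply: (kohn_closed_P2 Mc); first by rewrite d0 /= (le_lt_trans d2) // ltr_pdivrMr // mul1r ltr1n.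
  by split=> //; exists s, F; split=> // i; exact/IH/FM.
Qed.

Lemma germ_ideal_unit (I : set (func R n)) (u f : func R n) :
  germ_ideal I -> I u -> u 0 != 0 -> holo_germ f -> I f.
Proof.
move=> hI Iu u0 fh; have uh := germ_ideal_holo hI Iu.
have h := holo_germM fh (holo_germV uh u0).
apply: (germ_ideal_germ hI) (germ_idealM hI h Iu).
by apply: filterS (holo_germ_neq0 uh u0) => z uz; rewrite divfK.
Qed.

Lemma ideal_filtration_le l (I : nat -> set (func R n)) i j :
  ideal_filtration l I -> (1 <= i <= j)%N -> (j <= l)%N -> I i `<=` I j.
Proof.
move=> [_ hI] /andP[i1]; elim: j => [|j IH]; first by case: i i1.
rewrite leq_eqVlt => /predU1P[-> _|ij jl]; first exact: subset_refl.
apply: (subset_trans (IH ij (ltnW jl))).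
by apply: hI; rewrite (leq_trans i1).
Qed.

End KohnOrders.

Theorem proposition6p1 (R : realType) (n k : nat)
    (Gamma : Cn R n -> Cn R n) (I : nat -> set (func R n))
    (Q : nat -> func R n) (mu : nat -> option nat) (m : nat -> nat)
    (hk : (1 <= k < n)%N)
    (hGamma : holo_map_germ Gamma)
    (hI : ideal_filtration k.+1 I)
    (hQ : triangular_resolution k.+1 Gamma I Q mu)
    (hmu : forall j, (1 <= j <= k)%N -> mu j = Some (m j))
    (hJ : I k.+1 `<=`
          ideal_sum (I k)
            (ideal_gen (fun _ : 'I_1 => jac_det (component Gamma)))) :
  let N := (\prod_(1 <= j < k.+1) m j)%N in
  (exists2 M : set (func R n),
     kohn_generates (last_components k Gamma) k.+1 (I k) N N M &
     M (Q k.+1 \o Gamma)) /\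
  (forall (M : R -> set (func R n)) (eps : R),
     kohn_closed (last_components k Gamma) M ->
     0 < eps <= 1 / 2 -> I k `<=` M eps ->
     M ((2 * k + 2)%:R ^- N * eps) (Q k.+1 \o Gamma)).
Proof.
move=> N.
suff gen : exists2 M, kohn_generates (last_components k Gamma) k.+1 (I k) N N M &
    M (Q k.+1 \o Gamma).
  split=> // M eps Mc e0 IM; have [M' gM' M'Q] := gen.
  have := kohn_closed_generates Mc e0 IM gM' (ltn0Sn k) M'Q.
  (* $2^N(k+1)^N=(2k+2)^N$. *)
  rewrite -exprMn -[2]/(2%:R) -natrM mulnSr.
  by rewrite [X in M X _]mulrC.
have [/andP[k1 kn] [_ hQ']] := (hk, hQ).
have k1k : (1 <= k <= k.+1)%N by rewrite k1 leqnSn.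
have Ik : germ_ideal (I k) by apply: hI.1.
have leS i : (1 <= i <= k)%N -> (1 <= i <= k.+1)%N.
  by move=> /andP[-> /leqW].
have Qh i : (1 <= i <= k.+1)%N -> holo_germ (Q i) by move=> /hQ'[].
have Qd i : (1 <= i <= k.+1)%N -> depends_near i (Q i).
  by move=> /hQ'[_ /depends_from_near].
have IkQ i : (1 <= i <= k)%N -> I k (Q i \o Gamma).
  move=> ik; have [_ _ IQ _] := hQ' i (leS _ ik).
  by apply: (ideal_filtration_le hI ik) IQ; exact: leqnSn.
have Qu i : (1 <= i <= k)%N -> dQ Q i (m i) 0 != 0.
  move=> ik; have [_ _ _] := hQ' i (leS _ ik); rewrite (hmu i ik).
  exact: order_in_neq0.
have Q1h : holo_germ (Q k.+1 \o Gamma).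
  by apply: (holo_germ_comp hGamma); apply: Qh; rewrite leqnn.
(* If some $\mu_j=0$, then $Q_j\circ\Gamma$ is a unit in $I_k$, so $Q_{k+1}\circ\Gamma$ lies in
   $I_k$ at the outset, in accordance with $N=0$. *)
have [[j jk mj0]|mpos] := pselect (exists2 j, (1 <= j <= k)%N & m j = 0%N).
  have -> : N = 0%N.
    by rewrite /N (bigD1_seq j) ?iota_uniq ?mem_index_iota //= mj0 mul0n.
  exists (I k); first exact: kohn_start.
  apply: germ_ideal_unit Ik (IkQ j jk) _ Q1h.
  by rewrite /= hGamma.1; have := Qu j jk; rewrite mj0.
have m_gt0 i : (1 <= i <= k)%N -> (0 < m i)%N.
  by move=> ik; rewrite lt0n; apply/eqP => mi0; apply: mpos; exists i.
have [_ _ IQ1 _] := hQ' k.+1 (leqnn _ : (1 <= k.+1 <= k.+1)%N).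
have [f [g [If [c ch gc] Qfg]]] := hJ _ IQ1.
have Qfc : germ_eq (Q k.+1 \o Gamma)
    (fun z => f z + c ord0 z * jac_det (component Gamma) z).
  by apply: filterS2 Qfg gc => z -> ->; rewrite big_ord1.
(* At [j = k] no entry is prescribed in advance: the zero multi-index is a placeholder, and the two
   side conditions concern an empty range. *)
have [||M [gM _ MQ]] := @kohn_iterate R n k Gamma Q m kn hGamma Qh Qd Qu (I k) f
   (c ord0) If (ch ord0) Qfc IkQ m_gt0 k (fun=> 0%N) (I k) 0 0 (leqnn k) _
   (kohn_start _ _ _) _.
- by move=> i /andP[ki ik]; have := leq_trans ki ik; rewrite ltnn.
- by move=> i /andP[ki ik]; have := leq_trans ki ik; rewrite ltnn.
exists M; first exact: gM.
suff -> : Q k.+1 \o Gamma = tail k Q m (fun=> 0%N) k \o Gamma by [].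
by apply/funext => z; rewrite /tail /= big_geq // mulr1.
Qed.
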